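(* Let $M>0$ and $\alpha\in(0,1]$, let $f=h+\overline{g}\in\mathcal{P}_{\mathcal{H}}^0(\alpha,M)$ with $h(z)=z+\sum_{n=2}^\infty a_nz^n$ and $g(z)=\sum_{n=2}^\infty b_nz^n$ for $z\in\mathbb{D}$, and let $\phi\in\mathcal{A}$ be such that $\mathrm{Re}\left(\phi(z)/z\right)>1/2$ for $z\in\mathbb{D}$. Then $f*\left(\phi+\beta\overline{\phi}\right)\in\mathcal{P}_{\mathcal{H}}^0(\alpha,M)$ for every $\beta\in\mathbb{C}$ with $|\beta|=1$.
   Context: $\mathbb{D}=\{z\in\mathbb{C}:|z|<1\}$. $\mathcal{A}$ is the class of analytic functions $\phi$ in $\mathbb{D}$ with $\phi(0)=\phi'(0)-1=0$; at $z=0$, $\phi(z)/z$ is understood as its limit $1$. $\mathcal{H}$ is the class of complex-valued harmonic functions $f=h+\overline{g}$ in $\mathbb{D}$, with $h,g$ analytic in $\mathbb{D}$ and $h(0)=h'(0)-1=0$, $g(0)=0$. For $M>0$ and $\alpha\in(0,1]$, $\mathcal{P}_{\mathcal{H}}^0(\alpha,M)$ is the class of all $f=h+\overline{g}\in\mathcal{H}$ with $g'(0)=0$ and $$\mathrm{Re}\left((1-\alpha)h'(z)+\alpha zh''(z)\right)>-M+\left|(1-\alpha)g'(z)+\alpha zg''(z)\right|\quad\text{for all } z\in\mathbb{D}.$$ The convolution (Hadamard product) of analytic functions $\psi_1(z)=\sum_{n\ge0}a_nz^n$ and $\psi_2(z)=\sum_{n\ge0}b_nz^n$ in $\mathbb{D}$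 is $(\psi_1*\psi_2)(z)=\sum_{n\ge0}a_nb_nz^n$. For $f_1=h_1+\overline{g_1}$ and $f_2=h_2+\overline{g_2}$ in $\mathcal{H}$, the convolution is $f_1*f_2=h_1*h_2+\overline{g_1*g_2}$; here $\phi+\beta\overline{\phi}=\phi+\overline{\overline{\beta}\phi}$ has analytic part $\phi$ and co-analytic part $\overline{\beta}\phi$. *)

(* Defs.v *)
From Stdlib Require Import Reals ClassicalEpsilon.
From Coquelicot Require Export Coquelicot.
Open Scope R_scope.

Definition unit_disk (z : C) : Prop := Cmod z < 1.

(** [ex_derive] is taken over the field [C], so this is complex
    differentiability.  For such functions [C_derive], which is total, is the
    complex derivative. *)
Definition analytic_on_disk (psi : C -> C) : Prop :=
  forall z : C, unit_disk z ->
    @ex_derive C_AbsRing C_NormedModule psi z.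

Definition is_Cseries (u : nat -> C) (s : C) : Prop :=
  @is_series C_AbsRing C_NormedModule u s.

Definition CSeries (u : nat -> C) : C :=
  (Series (fun n => Re (u n)), Series (fun n => Im (u n))).

Definition expansion_on_disk (psi : C -> C) (a : nat -> C) : Prop :=
  forall z : C, unit_disk z -> is_Cseries (fun n => (a n * Cpow z n)%C) (psi z).

(** An analytic function has exactly one expansion on the disk; for other
    functions the choice below is arbitrary. *)
Definition coeffs (psi : C -> C) : nat -> C :=
  epsilon (inhabits (fun _ => RtoC 0)) (expansion_on_disk psi).

Definition hadamard (psi1 psi2 : C -> C) (z : C) : C :=
  CSeries (fun n => (coeffs psi1 n * coeffs psi2 n * Cpow z n)%C).

Definition class_A (phi : C -> C) : Prop :=
  analytic_on_disk phi /\ phi 0 = 0 /\ C_derive phi 0 = 1.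

(** phi(z)/z, extended at the origin by its limit for phi in [class_A]. *)
Definition div_id (phi : C -> C) (z : C) : C :=
  if Ceq_dec z 0 then RtoC 1 else (phi z / z)%C.

(** A harmonic function h + conj(g), given by its analytic and co-analytic
    parts; the normalization g(0) = 0 makes them unique on the disk. *)
Record harmonic_fun : Type := Harm { an_part : C -> C; coan_part : C -> C }.

Definition harm_val (f : harmonic_fun) (z : C) : C :=
  (an_part f z + Cconj (coan_part f z))%C.
Coercion harm_val : harmonic_fun >-> Funclass.

Definition class_H (f : harmonic_fun) : Prop :=
  analytic_on_disk (an_part f) /\ analytic_on_disk (coan_part f) /\
  an_part f 0 = 0 /\ C_derive (an_part f) 0 = 1 /\ coan_part f 0 = 0.

Definition class_PH0 (alpha M : R) (f : harmonic_fun) : Prop :=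
  class_H f /\
  C_derive (coan_part f) 0 = 0 /\
  let L (psi : C -> C) (z : C) : C :=
    (RtoC (1 - alpha) * C_derive psi z
     + RtoC alpha * z * C_derive (C_derive psi) z)%C in
  forall z : C, unit_disk z ->
    Re (L (an_part f) z) > - M + Cmod (L (coan_part f) z).

Definition harm_conv (f1 f2 : harmonic_fun) : harmonic_fun :=
  Harm (hadamard (an_part f1) (an_part f2))
       (hadamard (coan_part f1) (coan_part f2)).

Definition plus_conj (phi : C -> C) (beta : C) : harmonic_fun :=
  Harm phi (fun z => (Cconj beta * phi z)%C).

Lemma plus_conj_val (phi : C -> C) (beta z : C) :
  plus_conj phi beta z = (phi z + beta * Cconj (phi z))%C.
Proof.
unfold harm_val, plus_conj; simpl.
now rewrite Cmult_conj, Cconj_conj.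
Qed.

(* Main.v *)
(** On a circle inside the disk, for [Q = sum Q_n z^n] and [p = sum p_n z^n]
    with [p_0 = 1], the Hadamard product [sum Q_n p_n z^n] is the mean of the
    values of [Q] against the kernel [2 Re p - 1]; hence [Re Q > 0] and
    [Re p > 1/2] make its real part positive.  The operator [L] in the
    definition of the class multiplies Taylor coefficients, so it commutes with
    convolution.  Taking [p = phi(z)/z] and [Q = L h + e L g + M], with [e]
    running over the unit circle, turns the inequality for [h], [g] into the
    inequality for the convolution.

    The coefficients of [phi] exist because a function that is merely complex
    differentiable on the disk has a Taylor expansion.  This is Goursat's
    quartering argument, applied in polar coordinates to the difference quotient
    of the function at a point: its circular means vanish at radius [0] and do
    not depend on the radius, which gives Cauchy's formula on circles. *)

Require Import Defs.
From Stdlib Require Import Reals.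
From Coquelicot Require Import Coquelicot.
From Stdlib Require Import Lra Lia Classical ClassicalEpsilon.
Open Scope R_scope.

(** * Goursat's theorem for closed differentiable 1-forms *)

(** Quartering needs rectangles, while the argument needs circles. In polar coordinates an annulus
    becomes a rectangle whose two radial sides carry the same values and cancel. Complex
    differentiability then enters as a real 1-form P dx + Q dy with equal mixed partials at each
    point, the common value being [c] in [closed_form_on]; no continuity of the partials is assumed.
    The difference quotient at z is only known to be continuous at z, so the circle through z is
    reached by a limit in the radius. On the convolution side everything is carried by expansions:
    [coeffs] is a choice, so a Hadamard product can be computed only once coefficients are known to
    be unique, and the derivatives in [L] become weighted shifts. The shift made by [L] is the one
    made by phi(z)/z, so the two sequences multiply term by term. The rotations e are there because
    a modulus is not linear: |w| is the largest of the numbers Re (e w), and each of these is the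
    real part of an analytic function, to which the positive kernel applies. *)

Definition closed_form_on (P Q : R -> R -> R) (x1 x2 y1 y2 : R) : Prop :=
  forall x y, x1 <= x <= x2 -> y1 <= y <= y2 ->
  exists a b c,
    differentiable_pt_lim P x y a c /\ differentiable_pt_lim Q x y c b.

(** The boundary is run counterclockwise. Opposite sides are paired because the differentials
    control the difference of a coefficient between them. *)
Definition rect_circulation (P Q : R -> R -> R) (x1 x2 y1 y2 : R) : R :=
  (RInt (fun s => P s y1) x1 x2 - RInt (fun s => P s y2) x1 x2)
  + (RInt (fun t => Q x2 t) y1 y2 - RInt (fun t => Q x1 t) y1 y2).

Lemma continuity_2d_pt_slice1 (f : R -> R -> R) x y :
  continuity_2d_pt f x y -> continuous (fun s => f s y) x.
Proof.
intros H; apply continuity_pt_filterlim; intros eps Heps.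
destruct (H (mkposreal eps Heps)) as [d Hd].
exists d; split; [apply cond_pos|].
intros u [_ Hu]; apply Hd; [exact Hu|].
rewrite Rminus_diag, Rabs_R0; apply cond_pos.
Qed.

Lemma continuity_2d_pt_slice2 (f : R -> R -> R) x y :
  continuity_2d_pt f x y -> continuous (fun t => f x t) y.
Proof.
intros H; apply continuity_pt_filterlim; intros eps Heps.
destruct (H (mkposreal eps Heps)) as [d Hd].
exists d; split; [apply cond_pos|].
intros u [_ Hu]; apply Hd; [|exact Hu].
rewrite Rminus_diag, Rabs_R0; apply cond_pos.
Qed.

Lemma closed_form_continuous (P Q : R -> R -> R) x1 x2 y1 y2 x y :
  closed_form_on P Q x1 x2 y1 y2 -> x1 <= x <= x2 -> y1 <= y <= y2 ->
  continuity_2d_pt P x y /\ continuity_2d_pt Q x y.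
Proof.
intros H Hx Hy; destruct (H x y Hx Hy) as (a & b & c & HP & HQ).
split; apply differentiable_continuity_pt; eexists; eexists; eassumption.
Qed.

Lemma closed_form_ex_RInt1 (P Q : R -> R -> R) x1 x2 y1 y2 u v y :
  closed_form_on P Q x1 x2 y1 y2 -> x1 <= u <= v -> v <= x2 -> y1 <= y <= y2 ->
  ex_RInt (fun s => P s y) u v.
Proof.
intros H Hu Hv Hy; apply (ex_RInt_continuous (V := R_CompleteNormedModule)).
rewrite Rmin_left, Rmax_right by lra.
intros s Hs; apply (continuity_2d_pt_slice1 P).
apply (closed_form_continuous P Q x1 x2 y1 y2); auto; lra.
Qed.

Lemma closed_form_ex_RInt2 (P Q : R -> R -> R) x1 x2 y1 y2 u v x :
  closed_form_on P Q x1 x2 y1 y2 -> x1 <= x <= x2 -> y1 <= u <= v -> v <= y2 ->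
  ex_RInt (fun t => Q x t) u v.
Proof.
intros H Hx Hu Hv; apply (ex_RInt_continuous (V := R_CompleteNormedModule)).
rewrite Rmin_left, Rmax_right by lra.
intros s Hs; apply (continuity_2d_pt_slice2 Q).
apply (closed_form_continuous P Q x1 x2 y1 y2); auto; lra.
Qed.

Lemma RInt_minus_const_bound (f g : R -> R) (a b k M : R) :
  a <= b -> ex_RInt f a b -> ex_RInt g a b ->
  (forall x, a <= x <= b -> Rabs (f x - g x - k) <= M) ->
  Rabs (RInt f a b - RInt g a b - k * (b - a)) <= M * (b - a).
Proof.
intros Hab Hf Hg H.
assert (Hfg : is_RInt (fun x => f x - g x - k) a b
                (RInt f a b - RInt g a b - k * (b - a))).
{ replace (k * (b - a)) with (scal (b - a) k) by (unfold scal; simpl; unfold mult; simpl; ring).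
  apply (is_RInt_minus (V := R_NormedModule)); [|exact (is_RInt_const (V := R_NormedModule) a b k)].
  apply (is_RInt_minus (V := R_NormedModule)); apply (RInt_correct (V := R_CompleteNormedModule)); assumption. }
rewrite (Rmult_comm M).
apply (norm_RInt_le_const (V := R_NormedModule) _ a b _ M Hab H Hfg).
Qed.

(** The linear parts of the two coefficients contribute [- c] and [c] times the area, which cancel.
    What remains is at most [eps * m] at each point of each side, hence twice that for a pair of
    opposite sides. *)
Lemma rect_circulation_small (P Q : R -> R -> R) X1 X2 Y1 Y2 x y a b c :
  closed_form_on P Q X1 X2 Y1 Y2 ->
  differentiable_pt_lim P x y a c -> differentiable_pt_lim Q x y c b ->
  forall eps : posreal, exists d : posreal,
  forall x1 x2 y1 y2 m,
    X1 <= x1 <= x -> x <= x2 <= X2 -> Y1 <= y1 <= y -> y <= y2 <= Y2 ->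
    x2 - x1 <= m -> y2 - y1 <= m -> m < d ->
    Rabs (rect_circulation P Q x1 x2 y1 y2)
      <= 2 * eps * m * ((x2 - x1) + (y2 - y1)).
Proof.
intros Hcl HP HQ eps.
destruct (HP eps) as [d1 Hd1]; destruct (HQ eps) as [d2 Hd2].
assert (Hd : 0 < Rmin d1 d2) by (apply Rmin_glb_lt; apply cond_pos).
exists (mkposreal _ Hd); simpl.
intros x1 x2 y1 y2 m Hx1 Hx2 Hy1 Hy2 Hmx Hmy Hm.
assert (Hm1 := Rlt_le_trans _ _ _ Hm (Rmin_l d1 d2)).
assert (Hm2 := Rlt_le_trans _ _ _ Hm (Rmin_r d1 d2)).
assert (Eeps := cond_pos eps).
assert (Hsmall : forall u v, x1 <= u <= x2 -> y1 <= v <= y2 ->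
  Rabs (u - x) <= m /\ Rabs (v - y) <= m).
{ intros u v Hu Hv; split; apply Rabs_le; lra. }
assert (EP : forall u v, x1 <= u <= x2 -> y1 <= v <= y2 ->
  Rabs (P u v - P x y - (a * (u - x) + c * (v - y))) <= eps * m).
{ intros u v Hu Hv; destruct (Hsmall u v Hu Hv) as [Hu' Hv'].
  eapply Rle_trans; [apply Hd1; lra|].
  apply Rmult_le_compat_l; [lra|]; apply Rmax_lub; assumption. }
assert (EQ : forall u v, x1 <= u <= x2 -> y1 <= v <= y2 ->
  Rabs (Q u v - Q x y - (c * (u - x) + b * (v - y))) <= eps * m).
{ intros u v Hu Hv; destruct (Hsmall u v Hu Hv) as [Hu' Hv'].
  eapply Rle_trans; [apply Hd2; lra|].
  apply Rmult_le_compat_l; [lra|]; apply Rmax_lub; assumption. }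
assert (B1 : Rabs (RInt (fun s => P s y1) x1 x2 - RInt (fun s => P s y2) x1 x2
    - (- (c * (y2 - y1))) * (x2 - x1)) <= 2 * (eps * m) * (x2 - x1)).
{ apply RInt_minus_const_bound; [lra| | |].
  - apply (closed_form_ex_RInt1 P Q X1 X2 Y1 Y2); auto; lra.
  - apply (closed_form_ex_RInt1 P Q X1 X2 Y1 Y2); auto; lra.
  - intros s Hs.
    assert (E1 := EP s y1 Hs ltac:(lra)); assert (E2 := EP s y2 Hs ltac:(lra)).
    apply Rabs_le_between in E1; apply Rabs_le_between in E2; apply Rabs_le; lra. }
assert (B2 : Rabs (RInt (fun t => Q x2 t) y1 y2 - RInt (fun t => Q x1 t) y1 y2
    - (c * (x2 - x1)) * (y2 - y1)) <= 2 * (eps * m) * (y2 - y1)).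
{ apply RInt_minus_const_bound; [lra| | |].
  - apply (closed_form_ex_RInt2 P Q X1 X2 Y1 Y2); auto; lra.
  - apply (closed_form_ex_RInt2 P Q X1 X2 Y1 Y2); auto; lra.
  - intros s Hs.
    assert (E1 := EQ x2 s ltac:(lra) Hs); assert (E2 := EQ x1 s ltac:(lra) Hs).
    apply Rabs_le_between in E1; apply Rabs_le_between in E2; apply Rabs_le; lra. }
unfold rect_circulation.
apply Rabs_le_between in B1; apply Rabs_le_between in B2; apply Rabs_le; lra.
Qed.

Lemma rect_circulation_split (P Q : R -> R -> R) x1 x2 y1 y2 mx my :
  closed_form_on P Q x1 x2 y1 y2 -> x1 <= mx <= x2 -> y1 <= my <= y2 ->
  rect_circulation P Q x1 x2 y1 y2 =
    rect_circulation P Q x1 mx y1 my + rect_circulation P Q mx x2 y1 my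
    + rect_circulation P Q x1 mx my y2 + rect_circulation P Q mx x2 my y2.
Proof.
intros H Hx Hy; unfold rect_circulation.
assert (CP : forall y, y1 <= y <= y2 -> RInt (fun s => P s y) x1 x2 =
  RInt (fun s => P s y) x1 mx + RInt (fun s => P s y) mx x2).
{ intros y Hy'; symmetry; apply (RInt_Chasles (V := R_CompleteNormedModule));
  apply (closed_form_ex_RInt1 P Q x1 x2 y1 y2); auto; lra. }
assert (CQ : forall x, x1 <= x <= x2 -> RInt (fun t => Q x t) y1 y2 =
  RInt (fun t => Q x t) y1 my + RInt (fun t => Q x t) my y2).
{ intros x Hx'; symmetry; apply (RInt_Chasles (V := R_CompleteNormedModule));
  apply (closed_form_ex_RInt2 P Q x1 x2 y1 y2); auto; lra. }
rewrite (CP y1), (CP y2), (CQ x1), (CQ x2) by lra; ring.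
Qed.

Lemma quarter_bound (c w w1 w2 w3 w4 : R) :
  w = w1 + w2 + w3 + w4 -> c <= Rabs w ->
  c / 4 <= Rabs w1 \/ c / 4 <= Rabs w2 \/ c / 4 <= Rabs w3 \/ c / 4 <= Rabs w4.
Proof.
intros -> H.
assert (T1 := Rabs_triang (w1 + w2 + w3) w4).
assert (T2 := Rabs_triang (w1 + w2) w3).
assert (T3 := Rabs_triang w1 w2).
destruct (Rle_dec (c / 4) (Rabs w1)); [tauto|].
destruct (Rle_dec (c / 4) (Rabs w2)); [tauto|].
destruct (Rle_dec (c / 4) (Rabs w3)); [tauto|].
destruct (Rle_dec (c / 4) (Rabs w4)); [tauto|].
lra.
Qed.

Lemma dyadic_step (w : R) (n : nat) : w / 2 ^ n = w / 2 ^ S n + w / 2 ^ S n.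
Proof. simpl; field; apply pow_nonzero; lra. Qed.

Lemma closed_form_sub (P Q : R -> R -> R) X1 X2 Y1 Y2 x1 x2 y1 y2 :
  closed_form_on P Q X1 X2 Y1 Y2 -> X1 <= x1 -> x2 <= X2 -> Y1 <= y1 -> y2 <= Y2 ->
  closed_form_on P Q x1 x2 y1 y2.
Proof. intros H ? ? ? ? x y Hx Hy; apply H; lra. Qed.

(** Left ends increase and right ends decrease, so every left end lies below every right end, and
    the supremum of the left ends belongs to all the intervals. *)
Lemma nested_dyadic (u : nat -> R) (w : R) :
  0 <= w -> (forall n, u n <= u (S n) <= u n + w / 2 ^ S n) ->
  exists l, forall n, u n <= l <= u n + w / 2 ^ n.
Proof.
intros Hw Hu.
assert (Hp : forall n, 0 <= w / 2 ^ n).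
{ intros n; apply Rmult_le_pos; [lra|]; left; apply Rinv_0_lt_compat, pow_lt; lra. }
assert (Hdec : forall n, u (S n) + w / 2 ^ S n <= u n + w / 2 ^ n).
{ intros n; rewrite (dyadic_step w n); specialize (Hu n); lra. }
assert (Hm : forall n k, u n <= u (n + k)%nat /\ u (n + k)%nat + w / 2 ^ (n + k) <= u n + w / 2 ^ n).
{ intros n k; induction k as [|k IH].
  - rewrite Nat.add_0_r; lra.
  - rewrite Nat.add_succ_r; specialize (Hu (n + k)%nat); specialize (Hdec (n + k)%nat); lra. }
assert (Hub : forall n m, u m <= u n + w / 2 ^ n).
{ intros n m; destruct (Nat.le_ge_cases n m) as [Hnm|Hnm].
  - replace m with (n + (m - n))%nat by lia.
    specialize (Hm n (m - n)%nat); specialize (Hp (n + (m - n))%nat); lra.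
  - replace n with (m + (n - m))%nat by lia.
    specialize (Hm m (n - m)%nat); specialize (Hp (m + (n - m))%nat); lra. }
destruct (completeness (fun x => exists n, x = u n)) as [l [Hl1 Hl2]].
- exists (u 0%nat + w / 2 ^ 0); intros x [n ->]; apply Hub.
- exists (u 0%nat); now exists 0%nat.
- exists l; intros n; split.
  + apply Hl1; now exists n.
  + apply Hl2; intros x [m ->]; apply Hub.
Qed.

(** The sequences are the lower left corners of successive quarters, each keeping at least a fourth
    of the circulation of the previous one. *)
Lemma rect_circulation_descent (P Q : R -> R -> R) X Y w h :
  0 <= w -> 0 <= h -> closed_form_on P Q X (X + w) Y (Y + h) ->
  exists xs ys : nat -> R, forall n,
    X <= xs n /\ xs n + w / 2 ^ n <= X + w /\
    Y <= ys n /\ ys n + h / 2 ^ n <= Y + h /\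
    xs n <= xs (S n) <= xs n + w / 2 ^ S n /\
    ys n <= ys (S n) <= ys n + h / 2 ^ S n /\
    Rabs (rect_circulation P Q X (X + w) Y (Y + h)) / 4 ^ n <=
    Rabs (rect_circulation P Q (xs n) (xs n + w / 2 ^ n) (ys n) (ys n + h / 2 ^ n)).
Proof.
intros Hw Hh Hcl.
set (c := Rabs (rect_circulation P Q X (X + w) Y (Y + h))).
assert (Hpw : forall n, 0 <= w / 2 ^ n).
{ intros n; apply Rmult_le_pos; [lra|]; left; apply Rinv_0_lt_compat, pow_lt; lra. }
assert (Hph : forall n, 0 <= h / 2 ^ n).
{ intros n; apply Rmult_le_pos; [lra|]; left; apply Rinv_0_lt_compat, pow_lt; lra. }
pose (inv := fun (n : nat) (p : R * R) =>
  X <= fst p /\ fst p + w / 2 ^ n <= X + w /\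
  Y <= snd p /\ snd p + h / 2 ^ n <= Y + h /\
  c / 4 ^ n <= Rabs (rect_circulation P Q (fst p) (fst p + w / 2 ^ n)
                      (snd p) (snd p + h / 2 ^ n))).
(* The invariant stands under the existential so that the choice function [next] is total; where the
   invariant fails, [(0, 0)] is a dummy value. *)
assert (Hstep : forall n p, exists q, inv n p -> inv (S n) q /\
  fst p <= fst q <= fst p + w / 2 ^ S n /\ snd p <= snd q <= snd p + h / 2 ^ S n).
{ intros n [x y].
  destruct (excluded_middle_informative (inv n (x, y))) as [Hi|Hi];
    [|exists (0, 0); tauto].
  destruct Hi as (H1 & H2 & H3 & H4 & H5); simpl in H1, H2, H3, H4, H5.
  assert (Hw' := Hpw (S n)); assert (Hh' := Hph (S n)).
  assert (Ew := dyadic_step w n); assert (Eh := dyadic_step h n).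
  set (w' := w / 2 ^ S n) in *; set (h' := h / 2 ^ S n) in *.
  rewrite Ew, Eh in *.
  assert (E4 : c / 4 ^ S n = c / 4 ^ n / 4) by (simpl; field; apply pow_nonzero; lra).
  assert (Hs := rect_circulation_split P Q x (x + (w' + w')) y (y + (h' + h'))
     (x + w') (y + h')).
  assert (Hs' := fun A => Hs A ltac:(lra) ltac:(lra)); clear Hs.
  assert (Hsub : closed_form_on P Q x (x + (w' + w')) y (y + (h' + h')))
    by (apply (closed_form_sub _ _ _ _ _ _ _ _ _ _ Hcl); lra).
  assert (Hq := quarter_bound _ _ _ _ _ _ (Hs' Hsub) H5).
  replace (x + (w' + w')) with ((x + w') + w') in Hq by ring.
  replace (y + (h' + h')) with ((y + h') + h') in Hq by ring.
  unfold inv; rewrite E4; fold w' h'.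
  destruct Hq as [Hq|[Hq|[Hq|Hq]]];
    [exists (x, y)|exists (x + w', y)|exists (x, y + h')|exists (x + w', y + h')];
    intros _; simpl; repeat split; try lra; exact Hq. }
pose (next := fun n p => proj1_sig (constructive_indefinite_description _ (Hstep n p))).
pose (ps := nat_rect (fun _ => (R * R)%type) (X, Y) next).
assert (Hinv : forall n, inv n (ps n)).
{ intros n; induction n as [|n IH].
  - unfold inv; simpl; rewrite !Rdiv_1_r; fold c; repeat split; lra.
  - exact (proj1 (proj2_sig (constructive_indefinite_description _ (Hstep n (ps n))) IH)). }
exists (fun n => fst (ps n)), (fun n => snd (ps n)); intros n.
destruct (proj2_sig (constructive_indefinite_description _ (Hstep n (ps n))) (Hinv n))
  as (_ & H1 & H2).
destruct (Hinv n) as (H3 & H4 & H5 & H6 & H7).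
exact (conj H3 (conj H4 (conj H5 (conj H6 (conj H1 (conj H2 H7)))))).
Qed.

Lemma goursat_rect (P Q : R -> R -> R) x1 x2 y1 y2 :
  x1 <= x2 -> y1 <= y2 -> closed_form_on P Q x1 x2 y1 y2 ->
  rect_circulation P Q x1 x2 y1 y2 = 0.
Proof.
intros Hx Hy Hcl.
set (w := x2 - x1); set (h := y2 - y1).
assert (Ex : x2 = x1 + w) by (unfold w; ring).
assert (Ey : y2 = y1 + h) by (unfold h; ring).
assert (Hw : 0 <= w) by (unfold w; lra).
assert (Hh : 0 <= h) by (unfold h; lra).
rewrite Ex, Ey in *; clearbody w h; clear Ex Ey x2 y2 Hx Hy.
destruct (rect_circulation_descent P Q x1 y1 w h Hw Hh Hcl) as (xs & ys & Hs).
destruct (nested_dyadic xs w Hw) as [x Hx]; [intros n; apply Hs|].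
destruct (nested_dyadic ys h Hh) as [y Hy]; [intros n; apply Hs|].
destruct (Hcl x y) as (a & b & c & HP & HQ).
{ specialize (Hx 0%nat); specialize (Hs 0%nat); lra. }
{ specialize (Hy 0%nat); specialize (Hs 0%nat); lra. }
set (W := Rabs _) in Hs.
cut (W <= 0).
{ intros HW; assert (H0 := Rabs_pos (rect_circulation P Q x1 (x1 + w) y1 (y1 + h))).
  destruct (Req_dec (rect_circulation P Q x1 (x1 + w) y1 (y1 + h)) 0) as [E|E]; [exact E|].
  apply Rabs_pos_lt in E; fold W in E; lra. }
(* [m] bounds both sides and is half the perimeter, so the circulation at stage n is at most a small
   constant times m^2 / 4^n, the same rate as the lower bound [W / 4 ^ n]. *)
set (m := w + h).
assert (Hm : 0 <= m) by (unfold m; lra).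
assert (Hk : 0 < 2 * m * m + 1) by nra.
apply le_epsilon; intros eps Heps.
(* The denominator absorbs the constant 2 m^2 of the final estimate; the 1 keeps it positive for a
   degenerate rectangle. *)
assert (Heps' : 0 < eps / (2 * m * m + 1)) by (apply Rdiv_lt_0_compat; lra).
destruct (rect_circulation_small P Q _ _ _ _ x y a b c Hcl HP HQ (mkposreal _ Heps')) as [d Hd].
simpl in Hd.
assert (Hn : exists n, m / 2 ^ n < d).
{ destruct (pow_lt_1_zero (/ 2) ltac:(rewrite Rabs_right; lra) (d / (m + 1))) as [N HN].
  { apply Rdiv_lt_0_compat; [apply cond_pos|lra]. }
  exists N; specialize (HN N (le_n N)).
  rewrite Rabs_right in HN by (apply Rle_ge, pow_le; lra).
  rewrite pow_inv in HN; unfold Rdiv.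
  assert (Hi : 0 < / 2 ^ N) by (apply Rinv_0_lt_compat, pow_lt; lra).
  apply (Rmult_lt_compat_r (m + 1)) in HN; [|lra].
  replace (d / (m + 1) * (m + 1)) with (pos d) in HN by (field; lra).
  nra. }
destruct Hn as [n Hn].
assert (Hi : 0 < / 2 ^ n) by (apply Rinv_0_lt_compat, pow_lt; lra).
destruct (Hs n) as (H1 & H2 & H3 & H4 & _ & _ & H5).
specialize (Hx n); specialize (Hy n).
assert (Hb := Hd (xs n) (xs n + w / 2 ^ n) (ys n) (ys n + h / 2 ^ n) (m / 2 ^ n)).
replace (xs n + w / 2 ^ n - xs n) with (w / 2 ^ n) in Hb by ring.
replace (ys n + h / 2 ^ n - ys n) with (h / 2 ^ n) in Hb by ring.
assert (Hb' : W / 4 ^ n <= 2 * (eps / (2 * m * m + 1)) * (m / 2 ^ n) * (m / 2 ^ n)).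
{ eapply Rle_trans; [exact H5|]; eapply Rle_trans; [apply Hb|]; try lra;
    unfold m, Rdiv in *; nra. }
clear - Hb' Heps Hk.
replace (4 ^ n) with (2 ^ n * 2 ^ n) in Hb' by (rewrite <- Rpow_mult_distr; f_equal; ring).
assert (Hp : 0 < 2 ^ n) by (apply pow_lt; lra).
apply (Rmult_le_compat_r (2 ^ n * 2 ^ n)) in Hb'; [|nra].
replace (W / (2 ^ n * 2 ^ n) * (2 ^ n * 2 ^ n)) with W in Hb' by (field; lra).
replace (2 * (eps / (2 * m * m + 1)) * (m / 2 ^ n) * (m / 2 ^ n) * (2 ^ n * 2 ^ n))
  with (eps * (1 - / (2 * m * m + 1))) in Hb' by (field; lra).
assert (0 < / (2 * m * m + 1)) by (apply Rinv_0_lt_compat; lra).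
nra.
Qed.

(** * Complex differentiability and polar coordinates *)

Lemma C_is_derive_eps (f : C -> C) (z d : C) :
  @is_derive C_AbsRing C_NormedModule f z d <->
  forall eps : R, 0 < eps -> exists delta : R, 0 < delta /\
    forall w : C, Cmod (w - z) < delta ->
      Cmod (f w - f z - d * (w - z)) <= eps * Cmod (w - z).
Proof.
split.
- intros [_ H] eps Heps.
  destruct (H z (fun P HP => HP) (mkposreal eps Heps)) as [del Hdel].
  exists del; split; [apply cond_pos|]; intros w Hw.
  specialize (Hdel w Hw); rewrite (Cmult_comm d); exact Hdel.
- intros H; split; [apply is_linear_scal_l|].
  intros x Hx eps.
  assert (E := is_filter_lim_locally_unique (V := AbsRing_NormedModule C_AbsRing) z x Hx); subst x.
  destruct (H eps (cond_pos eps)) as (del & Hdel & Hb).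
  exists (mkposreal del Hdel); intros w Hw.
  specialize (Hb w Hw); rewrite (Cmult_comm d) in Hb; exact Hb.
Qed.

Lemma Cmod_le_abs (z : C) : Cmod z <= Rabs (Re z) + Rabs (Im z).
Proof.
replace z with (RtoC (Re z) + Ci * RtoC (Im z))%C at 1
  by (destruct z; unfold Re, Im, Ci, RtoC, Cmult, Cplus; simpl; f_equal; ring).
eapply Rle_trans; [apply Cmod_triangle|].
rewrite Cmod_mult, Cmod_Ci, !Cmod_R; lra.
Qed.

Lemma im_le_Cmod (z : C) : Rabs (Im z) <= Cmod z.
Proof. eapply Rle_trans; [apply Rmax_r|apply Rmax_Cmod]. Qed.

(** The Cauchy-Riemann equations at one point: multiplication by d acts on the plane with rows (Re
    d, - Im d) and (Im d, Re d). *)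
Lemma differentiable_pt_lim_holo (f : C -> C) (x y : R) (d : C) :
  @is_derive C_AbsRing C_NormedModule f (x, y) d ->
  differentiable_pt_lim (fun u v => Re (f (u, v))) x y (Re d) (- Im d) /\
  differentiable_pt_lim (fun u v => Im (f (u, v))) x y (Im d) (Re d).
Proof.
intros H.
assert (Hk : forall eps : posreal, exists delta : posreal, forall u v,
  Rabs (u - x) < delta -> Rabs (v - y) < delta ->
  Cmod (f (u, v) - f (x, y) - d * ((u, v) - (x, y))) <= eps * Rmax (Rabs (u - x)) (Rabs (v - y))).
{ intros eps.
  (* The modulus is at most the sum of the two coordinates, hence at most twice their maximum. *)
  destruct (proj1 (C_is_derive_eps _ _ _) H (eps / 2)) as (del & Hdel & Hb).
  { apply is_pos_div_2. }
  assert (Hd2 : 0 < del / 2) by lra.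
  exists (mkposreal _ Hd2); simpl; intros u v Hu Hv.
  assert (Hc : Cmod ((u, v) - (x, y))%C <= Rabs (u - x) + Rabs (v - y)) by
    apply (Cmod_le_abs ((u, v) - (x, y))%C).
  eapply Rle_trans; [apply Hb; lra|].
  assert (He := cond_pos eps).
  assert (A1 := Rmax_l (Rabs (u - x)) (Rabs (v - y))).
  assert (A2 := Rmax_r (Rabs (u - x)) (Rabs (v - y))).
  nra. }
split; intros eps; destruct (Hk eps) as [del Hdel]; exists del; intros u v Hu Hv;
  (eapply Rle_trans; [|apply (Hdel u v Hu Hv)]).
- eapply Rle_trans; [|apply re_le_Cmod]; apply Req_le; f_equal.
  unfold Re, Im, Cminus, Cmult, Cplus, Copp; simpl; ring.
- eapply Rle_trans; [|apply im_le_Cmod]; apply Req_le; f_equal.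
  unfold Re, Im, Cminus, Cmult, Cplus, Copp; simpl; ring.
Qed.

Lemma differentiable_pt_lim_Rmult (x y : R) : differentiable_pt_lim Rmult x y y x.
Proof.
intros eps; exists eps; intros u v Hu Hv.
replace (u * v - x * y - (y * (u - x) + x * (v - y))) with ((u - x) * (v - y)) by ring.
rewrite Rabs_mult.
apply Rmult_le_compat; try apply Rabs_pos; [lra|apply Rmax_r].
Qed.

Lemma differentiable_pt_lim_linear (a b x y : R) :
  differentiable_pt_lim (fun u v => a * u + b * v) x y a b.
Proof.
intros eps; exists eps; intros u v Hu Hv.
replace (a * u + b * v - (a * x + b * y) - (a * (u - x) + b * (v - y))) with 0 by ring.
rewrite Rabs_R0; apply Rmult_le_pos; [left; apply cond_pos|].
eapply Rle_trans; [apply Rabs_pos|apply Rmax_l].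
Qed.

Lemma differentiable_pt_lim_mult (f g : R -> R -> R) x y fx fy gx gy :
  differentiable_pt_lim f x y fx fy -> differentiable_pt_lim g x y gx gy ->
  differentiable_pt_lim (fun u v => f u v * g u v) x y
    (g x y * fx + f x y * gx) (g x y * fy + f x y * gy).
Proof.
exact (differentiable_pt_lim_comp Rmult f g x y _ _ _ _ _ _ (differentiable_pt_lim_Rmult _ _)).
Qed.

Lemma differentiable_pt_lim_lin (a b : R) (f g : R -> R -> R) x y fx fy gx gy :
  differentiable_pt_lim f x y fx fy -> differentiable_pt_lim g x y gx gy ->
  differentiable_pt_lim (fun u v => a * f u v + b * g u v) x y
    (a * fx + b * gx) (a * fy + b * gy).
Proof.
exact (differentiable_pt_lim_comp _ f g x y _ _ _ _ _ _ (differentiable_pt_lim_linear a b _ _)).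
Qed.

Lemma differentiable_pt_lim_fst (x y : R) : differentiable_pt_lim (fun u _ => u) x y 1 0.
Proof.
apply (differentiable_pt_lim_proj1_0 (fun u => u)), derivable_pt_lim_id.
Qed.

Lemma differentiable_pt_lim_snd (f : R -> R) (x y l : R) :
  derivable_pt_lim f y l -> differentiable_pt_lim (fun _ v => f v) x y 0 l.
Proof.
intros H eps.
destruct (differentiable_pt_lim_proj1_0 f y x l H eps) as [d Hd].
exists d; intros u v Hu Hv.
specialize (Hd v u Hv Hu); rewrite Rmax_comm.
replace (0 * (u - x) + l * (v - y)) with (l * (v - y) + 0 * (u - x)) by ring; exact Hd.
Qed.

Lemma differentiable_pt_lim_eq (f g : R -> R -> R) x y lx ly lx' ly' :
  (forall u v, g u v = f u v) -> differentiable_pt_lim g x y lx' ly' ->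
  lx = lx' -> ly = ly' -> differentiable_pt_lim f x y lx ly.
Proof.
intros E H -> ->; eapply differentiable_pt_lim_ext; [|exact H].
exists (mkposreal 1 Rlt_0_1); intros u v _ _; apply E.
Qed.

(** * The form q dz in polar coordinates *)

Definition cis (t : R) : C := (cos t, sin t).

Definition pol (r t : R) : C := (r * cos t, r * sin t).

(** With dz = e^(it) dr + i r e^(it) dt, the real part of q dz is P dr + Q dt, where P and Q are
    [polar_form_P] and [polar_form_Q]. Its imaginary part is reached, up to sign, by taking i q for
    q. *)
Definition polar_form_P (q : C -> C) (r t : R) : R :=
  cos t * Re (q (pol r t)) - sin t * Im (q (pol r t)).

Definition polar_form_Q (q : C -> C) (r t : R) : R :=
  - (r * (sin t * Re (q (pol r t)) + cos t * Im (q (pol r t)))).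

Lemma polar_form_closed (q : C -> C) (r t : R) :
  @ex_derive C_AbsRing C_NormedModule q (pol r t) ->
  exists a b c,
    differentiable_pt_lim (polar_form_P q) r t a c /\
    differentiable_pt_lim (polar_form_Q q) r t c b.
Proof.
intros [d Hd].
destruct (differentiable_pt_lim_holo q _ _ d Hd) as [HU HV].
assert (Hcos := differentiable_pt_lim_snd cos r t _ (derivable_pt_lim_cos t)).
assert (Hsin := differentiable_pt_lim_snd sin r t _ (derivable_pt_lim_sin t)).
assert (HX := differentiable_pt_lim_mult _ _ _ _ _ _ _ _ (differentiable_pt_lim_fst r t) Hcos).
assert (HY := differentiable_pt_lim_mult _ _ _ _ _ _ _ _ (differentiable_pt_lim_fst r t) Hsin).
assert (HU' := differentiable_pt_lim_comp _ _ _ _ _ _ _ _ _ _ _ HU HX HY).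
assert (HV' := differentiable_pt_lim_comp _ _ _ _ _ _ _ _ _ _ _ HV HX HY).
assert (HP := differentiable_pt_lim_lin 1 (-1) _ _ _ _ _ _ _ _
  (differentiable_pt_lim_mult _ _ _ _ _ _ _ _ Hcos HU')
  (differentiable_pt_lim_mult _ _ _ _ _ _ _ _ Hsin HV')).
assert (HQ := differentiable_pt_lim_mult _ _ _ _ _ _ _ _ (differentiable_pt_lim_fst r t)
  (differentiable_pt_lim_lin (-1) (-1) _ _ _ _ _ _ _ _
  (differentiable_pt_lim_mult _ _ _ _ _ _ _ _ Hsin HU')
  (differentiable_pt_lim_mult _ _ _ _ _ _ _ _ Hcos HV'))).
set (A := Re d) in *; set (B := Im d) in *.
set (U := Re (q (pol r t))); set (V := Im (q (pol r t))).
(* In the order a, b, c, the witnesses are the real parts of e^(2it) d, of - r e^(it) (q + r e^(it)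
   d) and of i e^(it) (q + r e^(it) d). The last is both the t-derivative of P and the r-derivative
   of Q. *)
exists ((A * cos t - B * sin t) * cos t - (B * cos t + A * sin t) * sin t),
  (- (r * (cos t * U - sin t * (r * (A * sin t + B * cos t))
     - sin t * V + cos t * (r * (A * cos t - B * sin t))))),
  (- (sin t * U + cos t * V + r * (sin t * (A * cos t - B * sin t)
     + cos t * (B * cos t + A * sin t)))).
split; [apply (differentiable_pt_lim_eq _ _ _ _ _ _ _ _) with (2 := HP)
       |apply (differentiable_pt_lim_eq _ _ _ _ _ _ _ _) with (2 := HQ)];
  unfold polar_form_P, polar_form_Q, U, V, pol; intros; simpl; ring.
Qed.

Lemma pol_2PI (r : R) : pol r (2 * PI) = pol r 0.
Proof. unfold pol; now rewrite cos_2PI, sin_2PI, cos_0, sin_0. Qed.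

Lemma Cmod_pol (r t : R) : 0 <= r -> Cmod (pol r t) = r.
Proof.
intros Hr; unfold Cmod, pol; simpl fst; simpl snd.
replace ((r * cos t) ^ 2 + (r * sin t) ^ 2) with (r ^ 2 * ((sin t)² + (cos t)²))
  by (unfold Rsqr; ring).
rewrite sin2_cos2, Rmult_1_r; now apply sqrt_pow2.
Qed.

Lemma two_PI_pos : 0 < 2 * PI.
Proof. assert (H := PI_RGT_0); lra. Qed.

Lemma polar_integral_const (q : C -> C) (r1 r2 : R) :
  0 <= r1 <= r2 ->
  (forall z, r1 <= Cmod z <= r2 -> @ex_derive C_AbsRing C_NormedModule q z) ->
  RInt (polar_form_Q q r1) 0 (2 * PI) = RInt (polar_form_Q q r2) 0 (2 * PI).
Proof.
intros Hr Hq; assert (H2 := two_PI_pos).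
assert (Hg := goursat_rect (polar_form_P q) (polar_form_Q q) r1 r2 0 (2 * PI)).
unfold rect_circulation in Hg.
replace (RInt (fun s => polar_form_P q s (2 * PI)) r1 r2)
  with (RInt (fun s => polar_form_P q s 0) r1 r2) in Hg.
- enough (H : RInt (fun s => polar_form_P q s 0) r1 r2 - RInt (fun s => polar_form_P q s 0) r1 r2 +
     (RInt (polar_form_Q q r2) 0 (2 * PI) - RInt (polar_form_Q q r1) 0 (2 * PI)) = 0) by lra.
  apply Hg; [lra|lra|].
  intros r t Hr' Ht; apply polar_form_closed, Hq; rewrite Cmod_pol; lra.
- apply RInt_ext; intros s _; unfold polar_form_P.
  now rewrite pol_2PI, cos_2PI, sin_2PI, cos_0, sin_0.
Qed.

(** * Complex continuity and difference quotients *)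

Definition C_continuous (f : C -> C) (z : C) : Prop :=
  @continuous (AbsRing_UniformSpace C_AbsRing) (AbsRing_UniformSpace C_AbsRing) f z.

Lemma C_continuous_eps (f : C -> C) (z : C) :
  C_continuous f z <->
  forall eps : R, 0 < eps -> exists delta : R, 0 < delta /\
    forall w : C, Cmod (w - z) < delta -> Cmod (f w - f z) < eps.
Proof.
split.
- intros H eps Heps.
  destruct (proj1 (filterlim_locally (F := @locally (AbsRing_UniformSpace C_AbsRing) z) (U := AbsRing_UniformSpace C_AbsRing) f (f z)) H (mkposreal eps Heps))
    as [d Hd].
  exists d; split; [apply cond_pos|exact Hd].
- intros H; apply (filterlim_locally (F := @locally (AbsRing_UniformSpace C_AbsRing) z) (U := AbsRing_UniformSpace C_AbsRing)); intros eps.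
  destruct (H eps (cond_pos eps)) as (d & Hd & Hb).
  exists (mkposreal d Hd); exact Hb.
Qed.

Lemma C_continuous_const (c z : C) : C_continuous (fun _ => c) z.
Proof.
exact (@continuous_const (AbsRing_UniformSpace C_AbsRing) (AbsRing_UniformSpace C_AbsRing) c z).
Qed.

Lemma C_continuous_mult (f g : C -> C) (z : C) :
  C_continuous f z -> C_continuous g z -> C_continuous (fun w => f w * g w)%C z.
Proof. exact (continuous_mult (U := AbsRing_UniformSpace C_AbsRing) (K := C_AbsRing) f g z). Qed.

Lemma C_continuous_plus (f g : C -> C) (z : C) :
  C_continuous f z -> C_continuous g z -> C_continuous (fun w => f w + g w)%C z.
Proof. exact (continuous_plus (U := AbsRing_UniformSpace C_AbsRing) (V := AbsRing_NormedModule C_AbsRing) f g z). Qed.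

Lemma C_continuous_minus (f g : C -> C) (z : C) :
  C_continuous f z -> C_continuous g z -> C_continuous (fun w => f w - g w)%C z.
Proof. exact (continuous_minus (U := AbsRing_UniformSpace C_AbsRing) (V := AbsRing_NormedModule C_AbsRing) f g z). Qed.

Lemma C_continuous_id (z : C) : C_continuous (fun w => w) z.
Proof. exact (@continuous_id (AbsRing_UniformSpace C_AbsRing) z). Qed.

Lemma C_continuous_inv (f : C -> C) (z : C) :
  C_continuous f z -> f z <> 0 -> C_continuous (fun w => / f w)%C z.
Proof.
intros H Hz; apply C_continuous_eps; intros eps Heps.
assert (Hm : 0 < Cmod (f z)) by now apply Cmod_gt_0.
set (m := Cmod (f z)) in *.
(* The first bound keeps |f w| above m / 2; given this, the second makes |f w - f z| smaller than
   eps |f w| m, as the difference of the inverses requires. *)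
assert (He : 0 < Rmin (m / 2) (eps * (m * m / 2))).
{ apply Rmin_glb_lt; [lra|]; apply Rmult_lt_0_compat; [lra|]; nra. }
destruct (proj1 (C_continuous_eps f z) H _ He) as (d & Hd & Hb).
exists d; split; [exact Hd|]; intros w Hw; specialize (Hb w Hw).
assert (H1 := Rlt_le_trans _ _ _ Hb (Rmin_l _ _)).
assert (H2 := Rlt_le_trans _ _ _ Hb (Rmin_r _ _)).
assert (Hfw : m / 2 < Cmod (f w)).
{ assert (T := Cmod_triangle (f w) (f z - f w)).
  replace (f w + (f z - f w))%C with (f z) in T by ring.
  replace (f z - f w)%C with (- (f w - f z))%C in T by ring.
  rewrite Cmod_opp in T; fold m in T; lra. }
assert (Hw0 : f w <> 0) by (apply Cmod_gt_0; lra).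
replace (/ f w - / f z)%C with (- (f w - f z) * / (f w * f z))%C by (field; auto).
rewrite Cmod_mult, Cmod_opp, Cmod_inv, Cmod_mult by now apply Cmult_neq_0.
fold m; apply (Rmult_lt_reg_r (Cmod (f w) * m)); [nra|].
rewrite Rmult_assoc, Rinv_l, Rmult_1_r by nra.
eapply Rlt_trans; [exact H2|].
apply Rmult_lt_compat_l; [lra|]; nra.
Qed.

Lemma C_continuous_ext_loc (f g : C -> C) (z : C) (d : R) :
  0 < d -> (forall w, Cmod (w - z) < d -> f w = g w) ->
  C_continuous f z -> C_continuous g z.
Proof.
intros Hd E H; apply C_continuous_eps; intros eps Heps.
destruct (proj1 (C_continuous_eps f z) H _ Heps) as (d' & Hd' & Hb).
exists (Rmin d d'); split; [now apply Rmin_glb_lt|]; intros w Hw.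
rewrite <- !E; [apply Hb; eapply Rlt_le_trans; [exact Hw|apply Rmin_r]| |].
- replace (z - z)%C with (RtoC 0) by ring; rewrite Cmod_0; lra.
- eapply Rlt_le_trans; [exact Hw|apply Rmin_l].
Qed.

(* Carathéodory's criterion, from which the product and quotient rules follow
   by continuity alone. *)
Lemma C_is_derive_slope (f s : C -> C) (z : C) (r : R) :
  0 < r -> C_continuous s z ->
  (forall w, Cmod (w - z) < r -> f w - f z = s w * (w - z))%C ->
  @is_derive C_AbsRing C_NormedModule f z (s z).
Proof.
intros Hr H E; apply C_is_derive_eps; intros eps Heps.
destruct (proj1 (C_continuous_eps s z) H _ Heps) as (d & Hd & Hb).
exists (Rmin r d); split; [now apply Rmin_glb_lt|]; intros w Hw.
assert (H1 := Rlt_le_trans _ _ _ Hw (Rmin_l _ _)).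
assert (H2 := Rlt_le_trans _ _ _ Hw (Rmin_r _ _)).
rewrite (E w H1); replace (s w * (w - z) - s z * (w - z))%C with ((s w - s z) * (w - z))%C by ring.
rewrite Cmod_mult; apply Rmult_le_compat_r; [apply Cmod_ge_0|]; left; auto.
Qed.

(** The derivative fills the gap at z, so that the function can be integrated along circles through
    z and is continuous there. *)
Definition slope (f : C -> C) (z w : C) : C :=
  if Ceq_dec w z then C_derive f z else ((f w - f z) / (w - z))%C.

Lemma slope_eq (f : C -> C) (z w : C) : (f w - f z = slope f z w * (w - z))%C.
Proof.
unfold slope; destruct (Ceq_dec w z) as [->|H]; [ring|].
field; intros E; apply H.
replace w with ((w - z) + z)%C by ring; rewrite E; ring.
Qed.

Lemma slope_continuous (f : C -> C) (z : C) :
  @ex_derive C_AbsRing C_NormedModule f z -> C_continuous (slope f z) z.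
Proof.
intros H; apply (C_derive_correct f z z) in H.
apply C_continuous_eps; intros eps Heps.
destruct (proj1 (C_is_derive_eps _ _ _) H (eps / 2)) as (d & Hd & Hb); [lra|].
exists d; split; [exact Hd|]; intros w Hw; specialize (Hb w Hw).
assert (Ez : slope f z z = C_derive f z) by (unfold slope; destruct (Ceq_dec z z); tauto).
rewrite Ez.
destruct (Ceq_dec w z) as [->|Hwz].
- rewrite Ez; replace (C_derive f z - C_derive f z)%C with (RtoC 0) by ring.
  rewrite Cmod_0; lra.
- rewrite slope_eq in Hb.
  replace (slope f z w * (w - z) - C_derive f z * (w - z))%C
    with ((slope f z w - C_derive f z) * (w - z))%C in Hb by ring.
  rewrite Cmod_mult in Hb.
  assert (Hp : 0 < Cmod (w - z)).
  { apply Cmod_gt_0; intros E; apply Hwz.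
    replace w with ((w - z) + z)%C by ring; rewrite E; ring. }
  apply Rmult_le_reg_r in Hb; lra.
Qed.

Lemma C_ex_derive_continuous (f : C -> C) (z : C) :
  @ex_derive C_AbsRing C_NormedModule f z -> C_continuous f z.
Proof.
intros H.
apply (C_continuous_ext_loc (fun w => slope f z w * (w - z) + f z)%C f z 1 Rlt_0_1).
- intros w _; rewrite <- slope_eq; ring.
- apply C_continuous_plus; [|apply C_continuous_const].
  apply C_continuous_mult; [now apply slope_continuous|].
  apply C_continuous_minus; [apply C_continuous_id|apply C_continuous_const].
Qed.

Lemma C_ex_derive_mult (f g : C -> C) (z : C) :
  @ex_derive C_AbsRing C_NormedModule f z -> @ex_derive C_AbsRing C_NormedModule g z ->
  @ex_derive C_AbsRing C_NormedModule (fun w => f w * g w)%C z.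
Proof.
intros Hf Hg; eexists.
apply (C_is_derive_slope _ (fun w => slope f z w * g w + f z * slope g z w)%C _ 1 Rlt_0_1).
- apply C_continuous_plus; apply C_continuous_mult;
    auto using C_continuous_const, slope_continuous, C_ex_derive_continuous.
- intros w _; assert (E1 := slope_eq f z w); assert (E2 := slope_eq g z w).
  replace (f w * g w - f z * g z)%C with ((f w - f z) * g w + f z * (g w - g z))%C by ring.
  rewrite E1, E2; ring.
Qed.

Lemma C_ex_derive_const (c z : C) : @ex_derive C_AbsRing C_NormedModule (fun _ => c) z.
Proof. apply ex_derive_const. Qed.

Lemma C_ex_derive_minus_const (f : C -> C) (c z : C) :
  @ex_derive C_AbsRing C_NormedModule f z ->
  @ex_derive C_AbsRing C_NormedModule (fun w => f w - c)%C z.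
Proof.
intros H; eexists; apply (C_is_derive_slope _ (slope f z) _ 1 Rlt_0_1).
- now apply slope_continuous.
- intros w _; rewrite <- slope_eq; ring.
Qed.

Lemma Cminus_neq_0 (z w : C) : z <> w -> (z - w <> 0)%C.
Proof.
intros H E; apply H; replace z with ((z - w) + w)%C by ring; rewrite E; ring.
Qed.

Lemma slope_ex_derive (f : C -> C) (z w : C) :
  w <> z -> @ex_derive C_AbsRing C_NormedModule f w ->
  @ex_derive C_AbsRing C_NormedModule (slope f z) w.
Proof.
intros Hwz Hf.
assert (Hp : 0 < Cmod (w - z)) by now apply Cmod_gt_0, Cminus_neq_0.
assert (Hne : forall v, Cmod (v - w) < Cmod (w - z) -> v <> z).
{ intros v Hv ->; replace (z - w)%C with (- (w - z))%C in Hv by ring.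
  rewrite Cmod_opp in Hv; lra. }
apply ex_derive_ext_loc with (f := fun v => ((f v - f z) * / (v - z))%C).
{ exists (mkposreal _ Hp); intros v Hv; unfold slope.
  destruct (Ceq_dec v z) as [E|_]; [now apply Hne in E|reflexivity]. }
apply C_ex_derive_mult; [now apply C_ex_derive_minus_const|].
(* From 1 / (v - z) - 1 / (w - z) = - (v - w) / ((v - z) (w - z)). *)
eexists; apply (C_is_derive_slope _ (fun v => - (/ (v - z)) * / (w - z))%C _ _ Hp).
- apply C_continuous_mult; [|apply C_continuous_const].
  apply (C_continuous_ext_loc (fun v => 0 - / (v - z))%C _ _ 1 Rlt_0_1); [intros; ring|].
  apply C_continuous_minus; [apply C_continuous_const|].
  apply C_continuous_inv; [|now apply Cminus_neq_0].
  apply C_continuous_minus; [apply C_continuous_id|apply C_continuous_const].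
- intros v Hv; field; split; apply Cminus_neq_0; auto.
Qed.

(** * Dependence of a circle integral on its radius *)

Lemma C_continuous_2d (q : C -> C) (x y : R) :
  C_continuous q (x, y) ->
  continuity_2d_pt (fun u v => Re (q (u, v))) x y /\
  continuity_2d_pt (fun u v => Im (q (u, v))) x y.
Proof.
intros H.
assert (Hk : forall eps : posreal, exists delta : posreal, forall u v,
  Rabs (u - x) < delta -> Rabs (v - y) < delta -> Cmod (q (u, v) - q (x, y)) < eps).
{ intros eps; destruct (proj1 (C_continuous_eps _ _) H eps (cond_pos eps)) as (d & Hd & Hb).
  exists (mkposreal _ (is_pos_div_2 (mkposreal d Hd))); simpl; intros u v Hu Hv.
  apply Hb; eapply Rle_lt_trans; [apply Cmod_le_abs|].
  change (Rabs (u - x) + Rabs (v - y) < d); lra. }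
split; intros eps; destruct (Hk eps) as [d Hd]; exists d; intros u v Hu Hv;
  (eapply Rle_lt_trans; [|apply (Hd u v Hu Hv)]).
- apply (re_le_Cmod (q (u, v) - q (x, y))).
- apply (im_le_Cmod (q (u, v) - q (x, y))).
Qed.

Lemma continuity_2d_pt_comp (f g h : R -> R -> R) (x y : R) :
  continuity_2d_pt f (g x y) (h x y) -> continuity_2d_pt g x y -> continuity_2d_pt h x y ->
  continuity_2d_pt (fun u v => f (g u v) (h u v)) x y.
Proof.
intros Hf Hg Hh eps; destruct (Hf eps) as [d Hd].
destruct (Hg d) as [d1 H1]; destruct (Hh d) as [d2 H2].
assert (Hm : 0 < Rmin d1 d2) by (apply Rmin_glb_lt; apply cond_pos).
exists (mkposreal _ Hm); simpl; intros u v Hu Hv; apply Hd; [apply H1|apply H2];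
  (eapply Rlt_le_trans; [eassumption|]); first [apply Rmin_l|apply Rmin_r].
Qed.

Lemma continuity_2d_pt_snd (f : R -> R) (x y : R) :
  continuity_pt f y -> continuity_2d_pt (fun _ v => f v) x y.
Proof.
intros H; apply (continuity_1d_2d_pt_comp f (fun _ v => v)); [exact H|].
apply continuity_2d_pt_id2.
Qed.

Lemma polar_form_Q_continuous (q : C -> C) (r t : R) :
  C_continuous q (pol r t) -> continuity_2d_pt (polar_form_Q q) r t.
Proof.
intros H; destruct (C_continuous_2d q _ _ H) as [HU HV].
assert (Hc := continuity_2d_pt_snd cos r t (continuity_cos t)).
assert (Hs := continuity_2d_pt_snd sin r t (continuity_sin t)).
assert (HX := continuity_2d_pt_mult _ _ _ _ (continuity_2d_pt_id1 r t) Hc).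
assert (HY := continuity_2d_pt_mult _ _ _ _ (continuity_2d_pt_id1 r t) Hs).
apply continuity_2d_pt_opp, continuity_2d_pt_mult; [apply continuity_2d_pt_id1|].
apply continuity_2d_pt_plus; apply continuity_2d_pt_mult; try assumption.
- exact (continuity_2d_pt_comp _ _ _ _ _ HU HX HY).
- exact (continuity_2d_pt_comp _ _ _ _ _ HV HX HY).
Qed.

(** Compactness of the segment over x gives one modulus of continuity for all t, so the integrands
    are uniformly close. *)
Lemma RInt_param_continuous (F : R -> R -> R) (a b x : R) :
  a < b -> (forall t, a <= t <= b -> continuity_2d_pt F x t) ->
  locally x (fun r => ex_RInt (F r) a b) ->
  continuity_pt (fun r => RInt (F r) a b) x.
Proof.
intros Hab HF [d0 Hex] eps Heps.
assert (He : 0 < eps / (2 * (b - a))) by (apply Rdiv_lt_0_compat; lra).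
destruct (uniform_continuity_2d_1d' F a b x HF (mkposreal _ He)) as [d Hd].
exists (Rmin d0 d); split; [apply Rmin_glb_lt; apply cond_pos|].
intros r [_ Hr]; change (Rabs (r - x) < Rmin d0 d) in Hr.
assert (H1 := Rlt_le_trans _ _ _ Hr (Rmin_l _ _)).
assert (H2 := Rlt_le_trans _ _ _ Hr (Rmin_r _ _)).
apply Rabs_lt_between in H2 as H3.
assert (Hb := RInt_minus_const_bound (F r) (F x) a b 0 (eps / (2 * (b - a)))).
change (Rabs (RInt (F r) a b - RInt (F x) a b) < eps).
replace (RInt (F r) a b - RInt (F x) a b) with
  (RInt (F r) a b - RInt (F x) a b - 0 * (b - a)) by ring.
eapply Rle_lt_trans; [apply Hb|].
- lra.
- apply Hex; exact H1.
- apply Hex, ball_center.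
- intros t Ht; rewrite Rminus_0_r; left.
  assert (Hp := cond_pos d).
  apply (Hd t x t r); simpl; try lra.
  rewrite Rminus_diag, Rabs_R0; lra.
- replace (eps / (2 * (b - a)) * (b - a)) with (eps / 2) by (field; lra); lra.
Qed.

(** Negative radii occur because continuity in the radius is two-sided, also at radius 0. *)
Lemma Cmod_pol_abs (r t : R) : Cmod (pol r t) = Rabs r.
Proof.
unfold Rabs; destruct (Rcase_abs r) as [H|H].
- replace (pol r t) with (- pol (- r) t)%C
    by (unfold pol, Copp; simpl; f_equal; ring).
  rewrite Cmod_opp; apply Cmod_pol; lra.
- apply Cmod_pol; lra.
Qed.

(** Carries the value of a circle integral across the radius |z|, where only continuity is
    available. *)
Lemma continuity_pt_const_right (K : R -> R) (x e c : R) :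
  0 < e -> continuity_pt K x -> (forall s, x < s < x + e -> K s = c) -> K x = c.
Proof.
intros He HK Hc; apply Rminus_diag_uniq, NNPP; intros Hne.
destruct (HK (Rabs (K x - c))) as (d & Hd & Hb); [now apply Rabs_pos_lt|].
assert (Hm : 0 < Rmin e d) by now apply Rmin_glb_lt.
assert (H1 := Rmin_l e d); assert (H2 := Rmin_r e d).
specialize (Hb (x + Rmin e d / 2)); simpl in Hb; unfold R_dist in Hb.
rewrite Hc in Hb by lra.
rewrite (Rabs_minus_sym c) in Hb; apply (Rlt_irrefl (Rabs (K x - c))), Hb.
split; [split; [exact I|lra]|].
replace (x + Rmin e d / 2 - x) with (Rmin e d / 2) by ring; rewrite Rabs_right; lra.
Qed.

(** The integral is constant for radii below |z| and for radii above |z|, because the closed annuli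
    involved miss z. Continuity at the radius |z| joins the two ranges. *)
Lemma polar_integral_zero (q : C -> C) (z : C) (r : R) :
  (forall w, unit_disk w -> C_continuous q w) ->
  (forall w, unit_disk w -> w <> z -> @ex_derive C_AbsRing C_NormedModule q w) ->
  0 <= r < 1 -> RInt (polar_form_Q q r) 0 (2 * PI) = 0.
Proof.
intros Hc Hd Hr; assert (H2 := two_PI_pos).
set (K := fun r => RInt (polar_form_Q q r) 0 (2 * PI)).
change (K r = 0).
assert (Hcont : forall s t, Rabs s < 1 -> continuity_2d_pt (polar_form_Q q) s t).
{ intros s t Hs; apply polar_form_Q_continuous, Hc; unfold unit_disk; now rewrite Cmod_pol_abs. }
assert (HK : forall s, 0 <= s < 1 -> continuity_pt K s).
{ intros s Hs; apply RInt_param_continuous; [exact H2|intros; apply Hcont|].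
  - rewrite Rabs_right; lra.
  - assert (Hp : 0 < 1 - s) by lra; exists (mkposreal _ Hp); intros u Hu.
    change (Rabs (u - s) < 1 - s) in Hu.
    apply (ex_RInt_continuous (V := R_CompleteNormedModule)); intros t _.
    apply (continuity_2d_pt_slice2 (polar_form_Q q)), Hcont.
    apply Rabs_lt_between in Hu; apply Rabs_lt_between; lra. }
assert (Hconst : forall s1 s2, 0 <= s1 <= s2 -> s2 < 1 ->
  (s2 < Cmod z \/ Cmod z < s1) -> K s1 = K s2).
{ intros s1 s2 Hs Hs2 Hz; apply polar_integral_const; [exact Hs|].
  intros w Hw; apply Hd; [unfold unit_disk; lra|intros ->; lra]. }
assert (K0 : K 0 = 0).
{ unfold K; rewrite (RInt_ext _ (fun _ => 0)).
  - rewrite RInt_const; unfold scal; simpl; unfold mult; simpl; ring.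
  - intros t _; change (polar_form_Q q 0 t = 0); unfold polar_form_Q; ring. }
assert (Hlow : forall s, 0 <= s < 1 -> s < Cmod z -> K s = 0).
{ intros s Hs Hz; rewrite <- K0; symmetry; apply Hconst; [lra|lra|now left]. }
destruct (Rlt_le_dec r (Cmod z)) as [Hz|Hz]; [now apply Hlow|].
assert (Hz0 := Cmod_ge_0 z).
assert (Hmid : K (Cmod z) = 0).
{ destruct Hz0 as [Hz0|<-]; [|exact K0].
  assert (Hz1 : Cmod z < 1) by lra.
  (* Here the known range lies to the left of |z|, so the one-sided lemma is applied to the
     reflected function s -> K (- s). *)
  replace (Cmod z) with (- (- Cmod z)) by ring.
  apply (continuity_pt_const_right (fun s => K (- s)) (- Cmod z) (Cmod z)); [lra| |].
  - apply (continuity_pt_comp (fun s => - s) K).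
    + apply continuity_pt_opp, continuity_pt_id.
    + rewrite Ropp_involutive; apply HK; lra.
  - intros s Hs; apply Hlow; lra. }
destruct Hz as [Hz|<-]; [|exact Hmid].
rewrite <- Hmid; symmetry.
apply (continuity_pt_const_right K (Cmod z) (r - Cmod z)); [lra|apply HK; lra|].
intros s Hs; apply Hconst; [lra|lra|right; lra].
Qed.

(** * Complex series and integrals over circles *)

Lemma sum_n_C (u : nat -> C) (n : nat) :
  @sum_n C_NormedModule u n = (sum_n (fun k => Re (u k)) n, sum_n (fun k => Im (u k)) n).
Proof.
induction n as [|n IH].
- rewrite !sum_O; apply surjective_pairing.
- rewrite !sum_Sn, IH; reflexivity.
Qed.

Lemma is_Cseries_components (u : nat -> C) (s : C) :
  is_Cseries u s <->
  is_series (fun n => Re (u n)) (Re s) /\ is_series (fun n => Im (u n)) (Im s).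
Proof.
unfold is_Cseries, is_series; split.
- destruct s as [s1 s2]; intros H; split.
  + apply filterlim_ext with (fun n => fst (@sum_n C_NormedModule u n)).
    { intros n; now rewrite sum_n_C. }
    apply filterlim_comp with (1 := H); exact (continuous_fst (U := R_UniformSpace) (V := R_UniformSpace) s1 s2).
  + apply filterlim_ext with (fun n => snd (@sum_n C_NormedModule u n)).
    { intros n; now rewrite sum_n_C. }
    apply filterlim_comp with (1 := H); exact (continuous_snd (U := R_UniformSpace) (V := R_UniformSpace) s1 s2).
- intros [H1 H2].
  apply filterlim_ext with (fun n => (sum_n (fun k => Re (u k)) n, sum_n (fun k => Im (u k)) n)).
  { intros n; now rewrite sum_n_C. }
  apply (filterlim_locally (U := C_UniformSpace)); intros eps.
  apply filter_and.
  + exact (proj1 (filterlim_locally (U := R_UniformSpace) _ _) H1 eps).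
  + exact (proj1 (filterlim_locally (U := R_UniformSpace) _ _) H2 eps).
Qed.

Lemma is_Cseries_unique (u : nat -> C) (s : C) : is_Cseries u s -> CSeries u = s.
Proof.
intros H; apply is_Cseries_components in H as [H1 H2].
unfold CSeries; rewrite (is_series_unique _ _ H1), (is_series_unique _ _ H2).
symmetry; apply surjective_pairing.
Qed.

Lemma is_Cseries_ext (u v : nat -> C) (s : C) :
  (forall n, u n = v n) -> is_Cseries u s -> is_Cseries v s.
Proof. intros E; now apply is_series_ext. Qed.

Lemma is_Cseries_plus (u v : nat -> C) (s t : C) :
  is_Cseries u s -> is_Cseries v t -> is_Cseries (fun n => u n + v n)%C (s + t)%C.
Proof. exact (is_series_plus u v s t). Qed.

Lemma is_Cseries_scal (c : C) (u : nat -> C) (s : C) :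
  is_Cseries u s -> is_Cseries (fun n => c * u n)%C (c * s)%C.
Proof. exact (is_series_scal (V := C_NormedModule) c u s). Qed.

Lemma is_Cseries_conj (u : nat -> C) (s : C) :
  is_Cseries u s -> is_Cseries (fun n => Cconj (u n)) (Cconj s).
Proof.
intros H; apply is_Cseries_components in H as [H1 H2]; apply is_Cseries_components.
split; [exact H1|exact (is_series_opp _ _ H2)].
Qed.

Lemma is_Cseries_ex (u : nat -> C) (M : nat -> R) :
  (forall n, Cmod (u n) <= M n) -> ex_series M -> is_Cseries u (CSeries u).
Proof.
intros H HM; apply is_Cseries_components; split; apply Series_correct;
  apply (ex_series_le (V := R_CompleteNormedModule)) with (2 := HM); intros n.
- eapply Rle_trans; [apply re_le_Cmod|apply H].
- eapply Rle_trans; [apply im_le_Cmod|apply H].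
Qed.

Lemma is_series_le_abs (u M : nat -> R) (s S : R) :
  (forall n, Rabs (u n) <= M n) -> is_series u s -> is_series M S -> Rabs s <= S.
Proof.
intros H Hu HM.
assert (Ha : ex_series (fun n => Rabs (u n))).
{ apply (ex_series_le (V := R_CompleteNormedModule)) with M; [|now exists S].
  intros n; change (Rabs (Rabs (u n)) <= M n); now rewrite Rabs_Rabsolu. }
rewrite <- (is_series_unique _ _ Hu), <- (is_series_unique _ _ HM).
eapply Rle_trans; [now apply Series_Rabs|].
apply Series_le; [|now exists S].
intros n; split; [apply Rabs_pos|apply H].
Qed.

(** The factor 2 comes from bounding the real and imaginary parts separately. *)
Lemma is_Cseries_bound (u : nat -> C) (M : nat -> R) (s : C) (S : R) :
  (forall n, Cmod (u n) <= M n) -> is_Cseries u s -> is_series M S -> Cmod s <= 2 * S.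
Proof.
intros H Hu HM; apply is_Cseries_components in Hu as [H1 H2].
assert (B1 : Rabs (Re s) <= S).
{ apply (is_series_le_abs _ _ _ _ (fun n => Rle_trans _ _ _ (re_le_Cmod (u n)) (H n)) H1 HM). }
assert (B2 : Rabs (Im s) <= S).
{ apply (is_series_le_abs _ _ _ _ (fun n => Rle_trans _ _ _ (im_le_Cmod (u n)) (H n)) H2 HM). }
assert (T := Cmod_le_abs s); lra.
Qed.

Lemma is_series_single (n : nat) (x : R) : is_series (fun k => if Nat.eqb k n then x else 0) x.
Proof.
change (is_lim_seq (sum_n (fun k => if Nat.eqb k n then x else 0)) x).
apply is_lim_seq_ext_loc with (fun _ => x); [|apply is_lim_seq_const].
exists n; intros N HN; symmetry.
induction N as [|N IH].
- replace n with 0%nat by lia; now rewrite sum_O.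
- rewrite sum_Sn; change plus with Rplus; cbv beta.
  destruct (Nat.eq_dec n (S N)) as [->|Hne].
  + rewrite Nat.eqb_refl.
    rewrite (sum_n_ext_loc _ (fun _ => 0)).
    * rewrite sum_n_const; ring.
    * intros k Hk; rewrite (proj2 (Nat.eqb_neq k (S N))); [reflexivity|lia].
  + rewrite (proj2 (Nat.eqb_neq (S N) n)) by lia.
    rewrite IH by lia; ring.
Qed.

(** This is how orthogonality is exploited: after integration term by term only one frequency is
    left. *)
Lemma is_Cseries_single (u : nat -> C) (n : nat) (s : C) :
  (forall k, k <> n -> u k = 0) -> is_Cseries u s -> s = u n.
Proof.
intros H Hu; rewrite <- (is_Cseries_unique _ _ Hu); apply is_Cseries_unique.
apply is_Cseries_components; split.
- apply is_series_ext with (2 := is_series_single n (Re (u n))); intros k.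
  destruct (Nat.eqb_spec k n) as [->|Hk]; [reflexivity|now rewrite (H k Hk)].
- apply is_series_ext with (2 := is_series_single n (Im (u n))); intros k.
  destruct (Nat.eqb_spec k n) as [->|Hk]; [reflexivity|now rewrite (H k Hk)].
Qed.

(** Convergence is absolute; the sum s is then identified from s - 1 = w s, where the left side is
    the shifted series. *)
Lemma is_Cseries_geom (w : C) :
  Cmod w < 1 -> is_Cseries (fun n => Cpow w n) (/ (1 - w))%C.
Proof.
intros Hw.
assert (Hw1 : (1 - w <> 0)%C).
{ apply Cminus_neq_0; intros E; rewrite <- E, Cmod_1 in Hw; lra. }
assert (Hs := is_Cseries_ex (fun n => Cpow w n) (fun n => Cmod w ^ n)
  (fun n => Req_le _ _ (Cmod_pow w n))).
assert (He : ex_series (fun n => Cmod w ^ n)).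
{ apply ex_series_geom; rewrite Rabs_right; [exact Hw|apply Rle_ge, Cmod_ge_0]. }
specialize (Hs He); set (s := CSeries _) in *; clearbody s.
replace (/ (1 - w))%C with s; [exact Hs|].
assert (H1 : is_Cseries (fun n => Cpow w (S n)) (s - 1)%C).
{ apply is_series_incr_1.
  change (is_Cseries (fun n => Cpow w n) (s - 1 + 1)%C).
  replace (s - 1 + 1)%C with s by ring; exact Hs. }
assert (H2 := is_Cseries_scal w _ _ Hs).
assert (E : (s - 1 = w * s)%C).
{ rewrite <- (is_Cseries_unique _ _ H1); now apply is_Cseries_unique. }
assert (Es : (s * (1 - w) = 1)%C).
{ replace (s * (1 - w))%C with (s - w * s)%C by ring; rewrite <- E; ring. }
replace s with (s * (1 - w) * / (1 - w))%C by (field; exact Hw1).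
rewrite Es; ring.
Qed.

(** Weierstrass test: uniformly in t, the partial sums differ from F by at most the tail of M, and
    integration multiplies this bound by b - a. *)
Lemma is_series_RInt (f : nat -> R -> R) (F : R -> R) (M l : nat -> R) (a b L : R) :
  a <= b ->
  (forall n, is_RInt (f n) a b (l n)) -> is_RInt F a b L ->
  (forall n t, a <= t <= b -> Rabs (f n t) <= M n) -> ex_series M ->
  (forall t, a <= t <= b -> is_series (fun n => f n t) (F t)) ->
  is_series l L.
Proof.
intros Hab Hf HF HM Hex Hs.
assert (HexM : exists S : R, is_series M S) by exact Hex; destruct HexM as [S HS].
assert (HsumM : forall n, is_series (fun k => M (Datatypes.S n + k)%nat) (S - sum_n M n)).
{ intros n; apply (is_series_incr_n (V := R_NormedModule)); [lia|].
  change (is_series M (S - sum_n M n + sum_n M n)); replace (S - sum_n M n + sum_n M n) with S by ring; exact HS. }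
assert (Hint : forall n, is_RInt (fun t => sum_n (fun k => f k t) n) a b (sum_n l n)).
{ induction n as [|n IH].
  - rewrite sum_O; apply is_RInt_ext with (2 := Hf 0%nat); intros t _; now rewrite sum_O.
  - rewrite sum_Sn; apply is_RInt_ext with (fun t => plus (sum_n (fun k => f k t) n) (f (Datatypes.S n) t)).
    + intros t _; now rewrite sum_Sn.
    + now apply (is_RInt_plus (V := R_NormedModule)). }
assert (Hdiff : forall n, Rabs (sum_n l n - L) <= (b - a) * (S - sum_n M n)).
{ intros n.
  apply (norm_RInt_le_const (V := R_NormedModule) (fun t => minus (sum_n (fun k => f k t) n) (F t)) a b
    (minus (sum_n l n) L) (S - sum_n M n) Hab).
  - intros t Ht; change (Rabs (sum_n (fun k => f k t) n - F t) <= S - sum_n M n).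
    rewrite Rabs_minus_sym.
    apply (is_series_le_abs (fun k => f (Datatypes.S n + k)%nat t) (fun k => M (Datatypes.S n + k)%nat)).
    + intros k; now apply HM.
    + apply (is_series_incr_n (V := R_NormedModule) (fun k => f k t)); [lia|].
      change (is_series (fun k => f k t) (F t - sum_n (fun k => f k t) n + sum_n (fun k => f k t) n)).
      replace (F t - sum_n (fun k => f k t) n + sum_n (fun k => f k t) n) with (F t) by ring.
      now apply Hs.
    + apply HsumM.
  - now apply (is_RInt_minus (V := R_NormedModule)). }
change (is_lim_seq (sum_n l) L); apply is_lim_seq_spec; intros eps.
assert (He : 0 < eps / (b - a + 1)) by (apply Rdiv_lt_0_compat; [apply cond_pos|lra]).
assert (HS' : is_lim_seq (sum_n M) S) by exact HS; apply is_lim_seq_spec in HS'.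
destruct (HS' (mkposreal _ He)) as [N HN]; simpl in HN.
exists N; intros n Hn; specialize (HN n Hn).
eapply Rle_lt_trans; [apply Hdiff|].
apply Rabs_lt_between in HN.
assert (H1 : S - sum_n M n < eps / (b - a + 1)) by lra.
apply (Rmult_lt_compat_r (b - a + 1)) in H1; [|lra].
replace (eps / (b - a + 1) * (b - a + 1)) with (pos eps) in H1 by (field; lra).
apply Rle_lt_trans with (2 := H1).
assert (H2 := Rle_trans _ _ _ (Rabs_pos _) (Hdiff n)).
(* For a < b the estimate [Hdiff] forces the tail to be nonnegative. For a = b it gives no sign, and
   the tail is compared with a series of zeros. *)
destruct (Req_dec a b) as [->|Hne].
- rewrite Rminus_diag, Rmult_0_l.
  assert (H3 : 0 <= S - sum_n M n).
  { eapply Rle_trans; [apply Rabs_pos|].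
    apply (is_series_le_abs (fun _ => 0) (fun k => M (Datatypes.S n + k)%nat) 0).
    - intros k; rewrite Rabs_R0; eapply Rle_trans; [apply Rabs_pos|apply (HM _ b); lra].
    - change (is_lim_seq (sum_n (fun _ => 0)) 0); apply is_lim_seq_ext with (fun _ => 0); [|apply is_lim_seq_const].
      intros k; rewrite sum_n_const; ring.
    - apply HsumM. }
  nra.
- assert (H3 : 0 <= S - sum_n M n) by nra.
  nra.
Qed.

(** * Integrals over the angle and the modes e^(ikt) *)

Definition is_circle_int (F : R -> C) (l : C) : Prop :=
  is_RInt (fun t => Re (F t)) 0 (2 * PI) (Re l) /\
  is_RInt (fun t => Im (F t)) 0 (2 * PI) (Im l).

Lemma is_circle_int_unique (F : R -> C) (l l' : C) :
  is_circle_int F l -> is_circle_int F l' -> l = l'.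
Proof.
intros [H1 H2] [H3 H4].
assert (E1 : Re l = Re l').
{ rewrite <- (is_RInt_unique _ _ _ _ H1); now apply is_RInt_unique. }
assert (E2 : Im l = Im l').
{ rewrite <- (is_RInt_unique _ _ _ _ H2); now apply is_RInt_unique. }
now apply injective_projections.
Qed.

Lemma is_circle_int_ext (F G : R -> C) (l : C) :
  (forall t, F t = G t) -> is_circle_int F l -> is_circle_int G l.
Proof.
intros E [H1 H2]; split; [apply is_RInt_ext with (2 := H1)|apply is_RInt_ext with (2 := H2)];
  intros t _; now rewrite E.
Qed.

Lemma is_circle_int_plus (F G : R -> C) (k l : C) :
  is_circle_int F k -> is_circle_int G l -> is_circle_int (fun t => F t + G t)%C (k + l)%C.
Proof.
intros [H1 H2] [H3 H4]; split.
- exact (is_RInt_plus _ _ _ _ _ _ H1 H3).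
- exact (is_RInt_plus _ _ _ _ _ _ H2 H4).
Qed.

Lemma is_circle_int_scal (c : C) (F : R -> C) (l : C) :
  is_circle_int F l -> is_circle_int (fun t => c * F t)%C (c * l)%C.
Proof.
intros [H1 H2]; split.
- exact (is_RInt_minus _ _ _ _ _ _ (is_RInt_scal _ _ _ (Re c) _ H1) (is_RInt_scal _ _ _ (Im c) _ H2)).
- exact (is_RInt_plus _ _ _ _ _ _ (is_RInt_scal _ _ _ (Re c) _ H2) (is_RInt_scal _ _ _ (Im c) _ H1)).
Qed.

Lemma is_circle_int_conj (F : R -> C) (l : C) :
  is_circle_int F l -> is_circle_int (fun t => Cconj (F t)) (Cconj l).
Proof. intros [H1 H2]; split; [exact H1|exact (is_RInt_opp _ _ _ _ H2)]. Qed.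

Lemma is_circle_int_series (v : nat -> R -> C) (F : R -> C) (M : nat -> R) (l : nat -> C) (L : C) :
  (forall n, is_circle_int (v n) (l n)) -> is_circle_int F L ->
  (forall n t, 0 <= t <= 2 * PI -> Cmod (v n t) <= M n) -> ex_series M ->
  (forall t, 0 <= t <= 2 * PI -> is_Cseries (fun n => v n t) (F t)) ->
  is_Cseries l L.
Proof.
intros Hv [HF1 HF2] HM Hex Hs; assert (H2 := two_PI_pos).
apply is_Cseries_components; split.
- apply (is_series_RInt (fun n t => Re (v n t)) (fun t => Re (F t)) M _ 0 (2 * PI)); auto; [lra| | |].
  + intros n; exact (proj1 (Hv n)).
  + intros n t Ht; eapply Rle_trans; [apply re_le_Cmod|now apply HM].
  + intros t Ht; now apply is_Cseries_components, Hs.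
- apply (is_series_RInt (fun n t => Im (v n t)) (fun t => Im (F t)) M _ 0 (2 * PI)); auto; [lra| | |].
  + intros n; exact (proj2 (Hv n)).
  + intros n t Ht; eapply Rle_trans; [apply im_le_Cmod|now apply HM].
  + intros t Ht; now apply is_Cseries_components, Hs.
Qed.

Definition path_continuous (F : R -> C) : Prop :=
  forall t, continuous (fun s => Re (F s)) t /\ continuous (fun s => Im (F s)) t.

Lemma path_continuous_const (c : C) : path_continuous (fun _ => c).
Proof. intros t; split; apply continuous_const. Qed.

Lemma path_continuous_plus (F G : R -> C) :
  path_continuous F -> path_continuous G -> path_continuous (fun t => F t + G t)%C.
Proof.
intros HF HG t; destruct (HF t), (HG t); split;
  now apply (continuous_plus (V := R_NormedModule)).
Qed.

Lemma path_continuous_mult (F G : R -> C) :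
  path_continuous F -> path_continuous G -> path_continuous (fun t => F t * G t)%C.
Proof.
intros HF HG t; destruct (HF t), (HG t); split.
- apply (continuous_minus (V := R_NormedModule)); now apply (continuous_mult (K := R_AbsRing)).
- apply (continuous_plus (V := R_NormedModule)); now apply (continuous_mult (K := R_AbsRing)).
Qed.

Lemma path_continuous_conj (F : R -> C) :
  path_continuous F -> path_continuous (fun t => Cconj (F t)).
Proof.
intros HF t; destruct (HF t); split; [assumption|].
now apply (continuous_opp (V := R_NormedModule)).
Qed.

Lemma path_continuous_eps (F : R -> C) (t eps : R) :
  path_continuous F -> 0 < eps ->
  exists d, 0 < d /\ forall s, Rabs (s - t) < d -> Cmod (F s - F t) < eps.
Proof.
intros HF Heps; destruct (HF t) as [H1 H2].
assert (He : 0 < eps / 2) by lra.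
apply (proj1 (filterlim_locally (U := R_UniformSpace) _ _)) with (eps := mkposreal _ He) in H1, H2.
destruct H1 as [d1 H1], H2 as [d2 H2].
exists (Rmin d1 d2); split; [apply Rmin_glb_lt; apply cond_pos|]; intros s Hs.
specialize (H1 s (Rlt_le_trans _ _ _ Hs (Rmin_l _ _))).
specialize (H2 s (Rlt_le_trans _ _ _ Hs (Rmin_r _ _))).
eapply Rle_lt_trans; [apply Cmod_le_abs|].
change (Rabs (Re (F s) - Re (F t)) < eps / 2) in H1.
change (Rabs (Im (F s) - Im (F t)) < eps / 2) in H2.
change (Rabs (Re (F s) - Re (F t)) + Rabs (Im (F s) - Im (F t)) < eps); lra.
Qed.

Lemma path_continuous_comp (q : C -> C) (F : R -> C) :
  path_continuous F -> (forall t, C_continuous q (F t)) -> path_continuous (fun t => q (F t)).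
Proof.
intros HF Hq t.
assert (Hk : forall eps : posreal, locally t (fun s => Cmod (q (F s) - q (F t)) < eps)).
{ intros eps; destruct (proj1 (C_continuous_eps _ _) (Hq t) eps (cond_pos eps)) as (d & Hd & Hb).
  destruct (path_continuous_eps F t d HF Hd) as (d' & Hd' & Hb').
  exists (mkposreal d' Hd'); intros s Hs; now apply Hb, Hb'. }
split; apply (filterlim_locally (U := R_UniformSpace)); intros eps;
  apply filter_imp with (2 := Hk eps); intros s Hs;
  (eapply Rle_lt_trans; [|exact Hs]).
- apply (re_le_Cmod (q (F s) - q (F t))).
- apply (im_le_Cmod (q (F s) - q (F t))).
Qed.

Definition circle_int (F : R -> C) : C :=
  (RInt (fun t => Re (F t)) 0 (2 * PI), RInt (fun t => Im (F t)) 0 (2 * PI)).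

Lemma circle_int_correct (F : R -> C) :
  path_continuous F -> is_circle_int F (circle_int F).
Proof.
intros HF; split; apply (RInt_correct (V := R_CompleteNormedModule));
  apply (ex_RInt_continuous (V := R_CompleteNormedModule)); intros t _; apply HF.
Qed.

Lemma path_continuous_bounded (F : R -> C) :
  path_continuous F -> exists B, 0 <= B /\ forall t, 0 <= t <= 2 * PI -> Cmod (F t) <= B.
Proof.
intros HF; assert (H2 := two_PI_pos).
assert (Hb : forall f : R -> R, (forall t, continuous f t) ->
  exists B, forall t, 0 <= t <= 2 * PI -> Rabs (f t) <= B).
{ intros f Hf.
  destruct (continuity_ab_maj (fun t => Rabs (f t)) 0 (2 * PI)) as (x & Hx & _); [lra| |].
  - intros t _; apply (continuity_pt_comp f Rabs); [|apply Rcontinuity_abs].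
    apply continuity_pt_filterlim, Hf.
  - now exists (Rabs (f x)). }
destruct (Hb (fun t => Re (F t))) as [B1 HB1]; [intros t; apply HF|].
destruct (Hb (fun t => Im (F t))) as [B2 HB2]; [intros t; apply HF|].
exists (B1 + B2); split.
- assert (T1 := HB1 0); assert (T2 := HB2 0).
  assert (P1 := Rabs_pos (Re (F 0))); assert (P2 := Rabs_pos (Im (F 0))); lra.
- intros t Ht; eapply Rle_trans; [apply Cmod_le_abs|].
  specialize (HB1 t Ht); specialize (HB2 t Ht); lra.
Qed.

Lemma cis_plus (s t : R) : (cis s * cis t = cis (s + t))%C.
Proof.
unfold cis, Cmult; simpl; rewrite cos_plus, sin_plus; f_equal; ring.
Qed.

Lemma cis_0 : cis 0 = 1.
Proof. unfold cis; now rewrite cos_0, sin_0. Qed.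

Lemma cis_opp (t : R) : cis (- t) = Cconj (cis t).
Proof. unfold cis, Cconj; simpl; now rewrite cos_neg, sin_neg. Qed.

Lemma Cmod_cis (t : R) : Cmod (cis t) = 1.
Proof.
unfold Cmod, cis; simpl fst; simpl snd.
replace (cos t ^ 2 + sin t ^ 2) with ((sin t)² + (cos t)²) by (unfold Rsqr; ring).
rewrite sin2_cos2; apply sqrt_1.
Qed.

Lemma cis_pow (t : R) (n : nat) : Cpow (cis t) n = cis (INR n * t).
Proof.
induction n as [|n IH].
- simpl; rewrite Rmult_0_l; symmetry; apply cis_0.
- rewrite Cpow_S, IH, cis_plus, S_INR; f_equal; ring.
Qed.

Lemma pol_cis (r t : R) : pol r t = (RtoC r * cis t)%C.
Proof. unfold pol, cis, RtoC, Cmult; simpl; f_equal; ring. Qed.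

Lemma path_continuous_cis (k : R) : path_continuous (fun t => cis (k * t)).
Proof.
intros t; split; apply continuity_pt_filterlim.
- apply (continuity_pt_comp (fun t => k * t) cos); [|apply continuity_cos].
  apply continuity_pt_mult; [now apply continuity_pt_const|apply continuity_pt_id].
- apply (continuity_pt_comp (fun t => k * t) sin); [|apply continuity_sin].
  apply continuity_pt_mult; [now apply continuity_pt_const|apply continuity_pt_id].
Qed.

Lemma is_circle_int_const (c : C) : is_circle_int (fun _ => c) (RtoC (2 * PI) * c)%C.
Proof.
split.
- replace (Re (RtoC (2 * PI) * c)%C) with (scal (2 * PI - 0) (Re c));
    [exact (is_RInt_const (V := R_NormedModule) 0 (2 * PI) (Re c))|].
  unfold scal, Re, Cmult; simpl; unfold mult; simpl; ring.
- replace (Im (RtoC (2 * PI) * c)%C) with (scal (2 * PI - 0) (Im c));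
    [exact (is_RInt_const (V := R_NormedModule) 0 (2 * PI) (Im c))|].
  unfold scal, Im, Cmult; simpl; unfold mult; simpl; ring.
Qed.

Lemma sin_int_period (k : Z) : sin (IZR k * (2 * PI)) = 0.
Proof.
apply sin_eq_0_1; exists (k * 2)%Z; rewrite mult_IZR; ring.
Qed.

Lemma cos_int_period (k : Z) : cos (IZR k * (2 * PI)) = 1.
Proof.
replace (IZR k * (2 * PI)) with (2 * (IZR k * PI)) by ring.
rewrite cos_2a_sin, (sin_eq_0_1 (IZR k * PI)); [ring|now exists k].
Qed.

Lemma is_circle_int_cis (k : Z) : k <> 0%Z -> is_circle_int (fun t => cis (IZR k * t)) 0.
Proof.
intros Hk; assert (Hk' : IZR k <> 0) by now apply not_0_IZR.
split; simpl.
- replace 0 with (minus (sin (IZR k * (2 * PI)) / IZR k) (sin (IZR k * 0) / IZR k)) at 2.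
  + apply (is_RInt_derive (V := R_CompleteNormedModule) (fun t => sin (IZR k * t) / IZR k)).
    * intros t _; auto_derive; [exact I|]; field; exact Hk'.
    * intros t _; apply (path_continuous_cis (IZR k) t).
  + rewrite sin_int_period, Rmult_0_r, sin_0; unfold minus, plus, opp; simpl; field; exact Hk'.
- replace 0 with (minus (- cos (IZR k * (2 * PI)) / IZR k) (- cos (IZR k * 0) / IZR k)) at 2.
  + apply (is_RInt_derive (V := R_CompleteNormedModule) (fun t => - cos (IZR k * t) / IZR k)).
    * intros t _; auto_derive; [exact I|]; field; exact Hk'.
    * intros t _; apply (path_continuous_cis (IZR k) t).
  + rewrite cos_int_period, Rmult_0_r, cos_0; unfold minus, plus, opp; simpl; field; exact Hk'.
Qed.

(** * Taylor expansion of analytic functions *)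

Definition disk_summable (u : nat -> C) : Prop :=
  forall r, 0 <= r < 1 -> ex_series (fun n => Cmod (u n) * r ^ n).

Lemma ex_series_bounded (a : nat -> R) :
  ex_series a -> exists B, 0 < B /\ forall n, Rabs (a n) <= B.
Proof.
intros H; apply maj_by_pos; exists 0.
apply is_lim_seq_Reals; now apply ex_series_lim_0.
Qed.

Lemma is_Cseries_bounded (u : nat -> C) (s : C) :
  is_Cseries u s -> exists B, 0 < B /\ forall n, Cmod (u n) <= B.
Proof.
intros H; apply is_Cseries_components in H as [H1 H2].
destruct (ex_series_bounded _ (ex_intro _ _ H1)) as (B1 & P1 & HB1).
destruct (ex_series_bounded _ (ex_intro _ _ H2)) as (B2 & P2 & HB2).
exists (B1 + B2); split; [lra|]; intros n.
eapply Rle_trans; [apply Cmod_le_abs|]; specialize (HB1 n); specialize (HB2 n); simpl in *; lra.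
Qed.

Lemma ex_series_scal_real (c : R) (a : nat -> R) :
  ex_series a -> ex_series (fun n => c * a n).
Proof. exact (ex_series_scal (V := R_NormedModule) c a). Qed.

Lemma ex_series_dominated (a b : nat -> R) :
  (forall n, 0 <= a n <= b n) -> ex_series b -> ex_series a.
Proof.
intros H; apply (ex_series_le (V := R_CompleteNormedModule)); intros n.
change (Rabs (a n) <= b n); rewrite Rabs_right; [apply H|apply Rle_ge, H].
Qed.

(** The terms of a convergent series are bounded, so those at radius r are dominated by a geometric
    series of ratio r / rho. *)
Lemma abel_summable (a : nat -> C) (rho r : R) (s : C) :
  0 <= r < rho -> is_Cseries (fun n => a n * Cpow (RtoC rho) n)%C s ->
  ex_series (fun n => Cmod (a n) * r ^ n).
Proof.
intros Hr H; destruct (is_Cseries_bounded _ _ H) as (B & HB & Hb).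
apply ex_series_dominated with (fun n => B * (r / rho) ^ n).
- intros n; assert (Hrn := pow_le r n (proj1 Hr)).
  split; [apply Rmult_le_pos; [apply Cmod_ge_0|exact Hrn]|].
  specialize (Hb n); rewrite Cmod_mult, Cmod_pow, Cmod_R, Rabs_right in Hb by lra.
  assert (Hp : 0 < rho ^ n) by (apply pow_lt; lra).
  unfold Rdiv; rewrite Rpow_mult_distr, pow_inv.
  replace (Cmod (a n) * r ^ n) with (Cmod (a n) * rho ^ n * (r ^ n * / rho ^ n)) by (field; lra).
  apply Rmult_le_compat_r; [|exact Hb].
  apply Rmult_le_pos; [exact Hrn|]; left; now apply Rinv_0_lt_compat.
- apply ex_series_scal_real, ex_series_geom.
  rewrite Rabs_right.
  + apply Rmult_lt_reg_r with rho; [lra|]; unfold Rdiv; rewrite Rmult_assoc, Rinv_l; lra.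
  + apply Rle_ge, Rmult_le_pos; [lra|]; left; apply Rinv_0_lt_compat; lra.
Qed.

Lemma expansion_summable (f : C -> C) (a : nat -> C) :
  expansion_on_disk f a -> disk_summable a.
Proof.
intros H r Hr; apply (abel_summable a ((1 + r) / 2) r (f (RtoC ((1 + r) / 2)))); [lra|].
apply H; unfold unit_disk; rewrite Cmod_R, Rabs_right; lra.
Qed.

Lemma path_continuous_pow (F : R -> C) (n : nat) :
  path_continuous F -> path_continuous (fun t => Cpow (F t) n).
Proof.
intros HF; induction n as [|n IH]; [exact (path_continuous_const 1)|].
now apply (path_continuous_mult F).
Qed.

Lemma path_continuous_ext (F G : R -> C) :
  (forall t, F t = G t) -> path_continuous F -> path_continuous G.
Proof.
intros E HF t; destruct (HF t) as [H1 H2]; split.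
- apply continuous_ext with (2 := H1); intros s; now rewrite E.
- apply continuous_ext with (2 := H2); intros s; now rewrite E.
Qed.

Lemma path_continuous_pol (r : R) : path_continuous (pol r).
Proof.
apply path_continuous_ext with (fun t => RtoC r * cis (1 * t))%C.
- intros t; now rewrite pol_cis, Rmult_1_l.
- apply path_continuous_mult; [apply path_continuous_const|apply path_continuous_cis].
Qed.

Lemma RInt_opp_zero (f g : R -> R) (a b : R) :
  ex_RInt f a b -> (forall t, g t = - f t) -> RInt g a b = 0 -> RInt f a b = 0.
Proof.
intros Hf E Hg.
assert (H : is_RInt g a b (- RInt f a b)).
{ apply is_RInt_ext with (fun t => opp (f t)); [intros t _; now rewrite E|].
  now apply (is_RInt_opp (V := R_NormedModule)), (RInt_correct (V := R_CompleteNormedModule)). }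
assert (E2 : RInt g a b = - RInt f a b) by now apply is_RInt_unique.
lra.
Qed.

(** On a circle dw = i w dt. Hence the polar form of the slope gives the imaginary part of this
    integral, and that of i times the slope its real part, both up to sign. *)
Lemma cauchy_circle (f : C -> C) (z : C) (r : R) :
  analytic_on_disk f -> unit_disk z -> 0 <= r < 1 ->
  is_circle_int (fun t => pol r t * slope f z (pol r t))%C 0.
Proof.
intros Hf Hz Hr.
assert (Hq : forall w, unit_disk w -> w <> z ->
  @ex_derive C_AbsRing C_NormedModule (slope f z) w).
{ intros w Hw Hwz; apply slope_ex_derive; auto. }
assert (Hc : forall w, unit_disk w -> C_continuous (slope f z) w).
{ intros w Hw; destruct (Ceq_dec w z) as [->|Hwz].
  - apply slope_continuous; auto.
  - apply C_ex_derive_continuous; auto. }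
assert (HF : path_continuous (fun t => pol r t * slope f z (pol r t))%C).
{ apply path_continuous_mult; [apply path_continuous_pol|].
  apply path_continuous_comp; [apply path_continuous_pol|].
  intros t; apply Hc; unfold unit_disk; rewrite Cmod_pol; lra. }
assert (HI := circle_int_correct _ HF).
replace (RtoC 0) with (circle_int (fun t => pol r t * slope f z (pol r t))%C); [exact HI|].
assert (Z1 := polar_integral_zero (slope f z) z r Hc Hq Hr).
assert (Z2 := polar_integral_zero (fun w => Ci * slope f z w)%C z r).
specialize (Z2 ltac:(intros w Hw; apply C_continuous_mult; [apply C_continuous_const|auto])
  ltac:(intros w Hw Hwz; apply C_ex_derive_mult; [apply C_ex_derive_const|auto]) Hr).
unfold circle_int, RtoC; f_equal.
- apply (RInt_opp_zero _ _ _ _ (ex_intro _ _ (proj1 HI))) with (2 := Z2).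
  intros t; unfold polar_form_Q, pol, Ci, Re, Im, Cmult; simpl; ring.
- apply (RInt_opp_zero _ _ _ _ (ex_intro _ _ (proj2 HI))) with (2 := Z1).
  intros t; unfold polar_form_Q, pol, Re, Im, Cmult; simpl; ring.
Qed.

Definition pol_inv (r t : R) : C := (RtoC (/ r) * cis (- t))%C.

Lemma pol_inv_l (r t : R) : r <> 0 -> (pol_inv r t * pol r t = 1)%C.
Proof.
intros Hr; rewrite pol_cis; unfold pol_inv.
replace (RtoC (/ r) * cis (- t) * (RtoC r * cis t))%C with
  (RtoC (/ r) * RtoC r * (cis (- t) * cis t))%C by ring.
rewrite cis_plus, Rplus_opp_l, cis_0, <- RtoC_mult, Rinv_l by exact Hr; ring.
Qed.

Lemma path_continuous_pol_inv (r : R) : path_continuous (pol_inv r).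
Proof.
apply path_continuous_ext with (fun t => RtoC (/ r) * cis (-1 * t))%C.
- intros t; unfold pol_inv; do 2 f_equal; ring.
- apply path_continuous_mult; [apply path_continuous_const|apply path_continuous_cis].
Qed.

Lemma Cmod_pol_inv (r t : R) : 0 < r -> Cmod (pol_inv r t) = / r.
Proof.
intros Hr; unfold pol_inv; rewrite Cmod_mult, Cmod_cis, Cmod_R, Rmult_1_r.
apply Rabs_right, Rle_ge; left; now apply Rinv_0_lt_compat.
Qed.

Lemma circle_int_pol_inv_pow (r : R) (n : nat) :
  n <> 0%nat -> is_circle_int (fun t => Cpow (pol_inv r t) n) 0.
Proof.
intros Hn.
replace (RtoC 0) with (Cpow (RtoC (/ r)) n * 0)%C by ring.
apply is_circle_int_ext with (fun t => Cpow (RtoC (/ r)) n * cis (IZR (- Z.of_nat n) * t))%C.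
- intros t; unfold pol_inv; rewrite Cpow_mult_l, cis_pow; do 2 f_equal.
  rewrite opp_IZR, <- INR_IZR_INZ; ring.
- apply is_circle_int_scal, is_circle_int_cis; lia.
Qed.

(** Cauchy's formula with the kernel 1 / (1 - z / w), for w on the circle, expanded as a geometric
    series. The coefficients, means of f(w) w^(-n), are built from the radius r; that they do not
    depend on it follows later from uniqueness. *)
Lemma taylor_at_radius (f : C -> C) (r : R) :
  analytic_on_disk f -> 0 < r < 1 ->
  exists a, forall z, Cmod z < r -> is_Cseries (fun n => a n * Cpow z n)%C (f z).
Proof.
intros Hf Hr; assert (H2 := two_PI_pos).
assert (Hpi : RtoC (2 * PI) <> 0) by (apply Cmod_gt_0; rewrite Cmod_R, Rabs_right; lra).
assert (Hfc : path_continuous (fun t => f (pol r t))).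
{ apply path_continuous_comp; [apply path_continuous_pol|].
  intros t; apply C_ex_derive_continuous, Hf; unfold unit_disk; rewrite Cmod_pol; lra. }
pose (A := fun n => circle_int (fun t => f (pol r t) * Cpow (pol_inv r t) n)%C).
assert (HA : forall n, is_circle_int (fun t => f (pol r t) * Cpow (pol_inv r t) n)%C (A n)).
{ intros n; apply circle_int_correct, path_continuous_mult; [exact Hfc|].
  apply path_continuous_pow, path_continuous_pol_inv. }
exists (fun n => / RtoC (2 * PI) * A n)%C; intros z Hz.
assert (Hx : forall t, Cmod (z * pol_inv r t) = Cmod z / r).
{ intros t; rewrite Cmod_mult, Cmod_pol_inv; lra. }
assert (Hx0 : 0 <= Cmod z / r).
{ apply Rmult_le_pos; [apply Cmod_ge_0|]; left; apply Rinv_0_lt_compat; lra. }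
assert (Hx1 : Cmod z / r < 1).
{ apply Rmult_lt_reg_r with r; [lra|]; unfold Rdiv; rewrite Rmult_assoc, Rinv_l; lra. }
assert (Hne : forall t, (1 - z * pol_inv r t <> 0)%C).
{ intros t; apply Cminus_neq_0; intros E; specialize (Hx t); rewrite <- E, Cmod_1 in Hx; lra. }
pose (G := fun t => (/ (1 - z * pol_inv r t))%C).
assert (HGs : forall t, is_Cseries (fun n => Cpow (z * pol_inv r t) n) (G t)).
{ intros t; apply is_Cseries_geom; rewrite Hx; exact Hx1. }
assert (HGc : path_continuous G).
{ apply (path_continuous_comp (fun w => / w)%C (fun t => 1 - z * pol_inv r t)%C).
  - apply path_continuous_ext with (fun t => 1 + (- z) * pol_inv r t)%C; [intros t; ring|].
    apply path_continuous_plus; [apply path_continuous_const|].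
    apply path_continuous_mult; [apply path_continuous_const|apply path_continuous_pol_inv].
  - intros t; apply (C_continuous_inv (fun w => w)); [apply C_continuous_id|apply Hne]. }
assert (Hgeom : ex_series (fun n => (Cmod z / r) ^ n)).
{ apply ex_series_geom; now rewrite Rabs_right by lra. }
assert (I1 := circle_int_correct _ (path_continuous_mult _ _ Hfc HGc)).
assert (I2 := circle_int_correct _ HGc).
set (L1 := circle_int _) in I1; set (L2 := circle_int _) in I2.
assert (S1 : is_Cseries (fun n => Cpow z n * A n)%C L1).
{ destruct (path_continuous_bounded _ Hfc) as (B & HB & Hb).
  apply (is_circle_int_series (fun n t => Cpow z n * (f (pol r t) * Cpow (pol_inv r t) n))%C
    _ (fun n => B * (Cmod z / r) ^ n) _ _ (fun n => is_circle_int_scal _ _ _ (HA n)) I1).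
  - intros n t Ht.
    replace (Cpow z n * (f (pol r t) * Cpow (pol_inv r t) n))%C
      with (f (pol r t) * Cpow (z * pol_inv r t) n)%C by (rewrite Cpow_mult_l; ring).
    rewrite Cmod_mult, Cmod_pow, Hx; apply Rmult_le_compat_r; [now apply pow_le|auto].
  - now apply ex_series_scal_real.
  - intros t Ht; apply is_Cseries_ext with (fun n => f (pol r t) * Cpow (z * pol_inv r t) n)%C.
    + intros n; rewrite Cpow_mult_l; ring.
    + apply is_Cseries_scal, HGs. }
(* Only the constant mode of the kernel has a nonzero integral. *)
assert (S2 : L2 = RtoC (2 * PI)).
{ pose (l := fun n : nat => if Nat.eqb n 0 then RtoC (2 * PI) else RtoC 0).
  change (RtoC (2 * PI)) with (l 0%nat); apply is_Cseries_single.
  - intros [|k] Hk; [tauto|reflexivity].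
  - apply (is_circle_int_series (fun n t => Cpow (z * pol_inv r t) n) G
      (fun n => (Cmod z / r) ^ n)); auto.
    + intros [|n].
      * replace (l 0%nat) with (RtoC (2 * PI) * 1)%C by (unfold l; simpl; ring).
        apply is_circle_int_ext with (fun _ => RtoC 1); [reflexivity|apply is_circle_int_const].
      * replace (l (S n)) with (Cpow z (S n) * 0)%C by (unfold l; simpl; ring).
        apply is_circle_int_ext with (fun t => Cpow z (S n) * Cpow (pol_inv r t) (S n))%C.
        { intros t; now rewrite Cpow_mult_l. }
        apply is_circle_int_scal, circle_int_pol_inv_pow; lia.
    + intros n t _; rewrite Cmod_pow, Hx; lra. }
assert (I3 := cauchy_circle f z r Hf ltac:(unfold unit_disk; lra) ltac:(lra)).
(* The kernel G is w / (w - z), so w times the slope is (f(w) - f(z)) G, and [cauchy_circle]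
   integrates it to 0. *)
assert (E : (RtoC 0 = L1 + (- f z) * L2)%C).
{ apply is_circle_int_unique with (1 := I3).
  eapply is_circle_int_ext; [|exact (is_circle_int_plus _ _ _ _ I1 (is_circle_int_scal (- f z)%C _ _ I2))].
  intros t; simpl.
  assert (Hzt : pol r t <> z).
  { intros E; rewrite <- E, Cmod_pol in Hz; lra. }
  assert (Hs := slope_eq f z (pol r t)).
  assert (Hi := pol_inv_l r t ltac:(lra)).
  transitivity ((f (pol r t) - f z) * G t)%C; [ring|].
  rewrite Hs; transitivity (slope f z (pol r t) * ((pol r t - z) * G t))%C; [ring|].
  rewrite (Cmult_comm (pol r t) (slope _ _ _)); f_equal.
  replace (pol r t - z)%C with (pol r t * (1 - z * pol_inv r t))%C.
  - unfold G; field; apply Hne.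
  - replace (pol r t * (1 - z * pol_inv r t))%C with (pol r t - z * (pol_inv r t * pol r t))%C by ring.
    rewrite Hi; ring. }
replace (f z) with (/ RtoC (2 * PI) * L1)%C.
- apply is_Cseries_ext with (fun n => / RtoC (2 * PI) * (Cpow z n * A n))%C.
  + intros n; ring.
  + now apply is_Cseries_scal.
- rewrite S2 in E; replace L1 with ((L1 + - f z * RtoC (2 * PI)) + f z * RtoC (2 * PI))%C by ring.
  rewrite <- E; field; exact Hpi.
Qed.

(** The conclusion is a series with at most one nonzero term so that negative k is covered as well:
    then no index matches and [L] is 0. *)
Lemma circle_int_coeff (w : nat -> C) (F : R -> C) (k : Z) (L : C) :
  ex_series (fun n => Cmod (w n)) ->
  (forall t, is_Cseries (fun n => w n * cis (INR n * t))%C (F t)) ->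
  is_circle_int (fun t => F t * cis (- IZR k * t))%C L ->
  is_Cseries (fun n => if Z.eqb (Z.of_nat n) k then RtoC (2 * PI) * w n else 0)%C L.
Proof.
intros Hw HF HL.
apply (is_circle_int_series (fun n t => w n * cis (IZR (Z.of_nat n - k) * t))%C
  _ (fun n => Cmod (w n)) _ _) with (2 := HL); [| |exact Hw|].
- intros n; destruct (Z.eqb_spec (Z.of_nat n) k) as [E|E].
  + apply is_circle_int_ext with (fun _ => w n); [|apply is_circle_int_const].
    intros t; rewrite <- E, Z.sub_diag, Rmult_0_l, cis_0; ring.
  + replace (RtoC 0) with (w n * 0)%C by ring; apply is_circle_int_scal, is_circle_int_cis; lia.
- intros n t _; rewrite Cmod_mult, Cmod_cis; lra.
- intros t _; apply is_Cseries_ext with (fun n => cis (- IZR k * t) * (w n * cis (INR n * t)))%C.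
  + intros n; rewrite minus_IZR, <- INR_IZR_INZ.
    replace ((INR n - IZR k) * t) with (INR n * t + - IZR k * t) by ring.
    rewrite <- cis_plus; ring.
  + rewrite (Cmult_comm (F t)); apply is_Cseries_scal, HF.
Qed.

Lemma circle_int_coeff_nat (w : nat -> C) (F : R -> C) (n : nat) (L : C) :
  ex_series (fun n => Cmod (w n)) ->
  (forall t, is_Cseries (fun n => w n * cis (INR n * t))%C (F t)) ->
  is_circle_int (fun t => F t * cis (- INR n * t))%C L -> L = (RtoC (2 * PI) * w n)%C.
Proof.
intros Hw HF HL; rewrite INR_IZR_INZ in HL.
assert (Hs := circle_int_coeff w F _ L Hw HF HL).
apply (is_Cseries_single _ n) in Hs; [now rewrite Z.eqb_refl in Hs|].
intros k Hk; destruct (Z.eqb_spec (Z.of_nat k) (Z.of_nat n)); [lia|reflexivity].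
Qed.

(** On a circle inside the disk the sum is the zero function, while its Fourier coefficients are 2
    PI u_n r^n. *)
Lemma power_series_zero (u : nat -> C) (rho : R) :
  0 < rho -> (forall z, Cmod z < rho -> is_Cseries (fun n => u n * Cpow z n)%C 0) ->
  forall n, u n = 0.
Proof.
intros Hrho H n; assert (H2 := two_PI_pos).
(* Convergence at r' gives absolute convergence on the smaller circle of radius r. *)
set (r := rho / 2); set (r' := 3 * rho / 4).
assert (Hsum : ex_series (fun n => Cmod (u n) * r ^ n)).
{ apply (abel_summable u r' r 0); [unfold r, r'; lra|].
  apply H; rewrite Cmod_R, Rabs_right; unfold r'; lra. }
assert (Hr : 0 < r) by (unfold r; lra).
assert (E : (RtoC 0 = RtoC (2 * PI) * (u n * Cpow (RtoC r) n))%C).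
{ apply (circle_int_coeff_nat (fun n => u n * Cpow (RtoC r) n)%C (fun _ => 0)).
  - apply ex_series_ext with (2 := Hsum); intros k.
    now rewrite Cmod_mult, Cmod_pow, Cmod_R, Rabs_right by lra.
  - intros t; apply is_Cseries_ext with (2 := H (pol r t) ltac:(rewrite Cmod_pol; unfold r in *; lra)).
    intros k; rewrite pol_cis, Cpow_mult_l, cis_pow; ring.
  - apply is_circle_int_ext with (fun _ => RtoC 0); [intros; ring|].
    assert (H0 := is_circle_int_const 0); now rewrite Cmult_0_r in H0. }
assert (Hpi : RtoC (2 * PI) <> 0) by (apply Cmod_gt_0; rewrite Cmod_R, Rabs_right; lra).
assert (Hrn : Cpow (RtoC r) n <> 0).
{ apply Cpow_nz, Cmod_gt_0; rewrite Cmod_R, Rabs_right; lra. }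
destruct (Ceq_dec (u n) 0) as [E0|E0]; [exact E0|].
symmetry in E; exfalso; revert E; apply Cmult_neq_0; [exact Hpi|now apply Cmult_neq_0].
Qed.

Lemma power_series_unique (f : C -> C) (a b : nat -> C) (rho : R) :
  0 < rho ->
  (forall z, Cmod z < rho -> is_Cseries (fun n => a n * Cpow z n)%C (f z)) ->
  (forall z, Cmod z < rho -> is_Cseries (fun n => b n * Cpow z n)%C (f z)) ->
  forall n, a n = b n.
Proof.
intros Hrho Ha Hb n.
assert (E : (a n + (-1) * b n = 0)%C).
{ apply (power_series_zero (fun n => a n + (-1) * b n)%C rho Hrho); intros z Hz.
  replace (RtoC 0) with (f z + (-1) * f z)%C by ring.
  apply is_Cseries_ext with (fun n => a n * Cpow z n + (-1) * (b n * Cpow z n))%C; [intros; ring|].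
  apply is_Cseries_plus; [now apply Ha|]; now apply is_Cseries_scal, Hb. }
replace (a n) with ((a n + (-1) * b n) + b n)%C by ring; rewrite E; ring.
Qed.

(** The coefficients found at radius 1 / 2 serve on the whole disk: those of a larger radius
    reaching z agree with them, by uniqueness on the smaller disk. *)
Lemma analytic_expansion (f : C -> C) :
  analytic_on_disk f -> exists a, expansion_on_disk f a.
Proof.
intros Hf; destruct (taylor_at_radius f (1 / 2) Hf) as [a Ha]; [lra|].
exists a; intros z Hz; unfold unit_disk in Hz; assert (Hz0 := Cmod_ge_0 z).
destruct (taylor_at_radius f (Rmax (1 / 2) ((1 + Cmod z) / 2)) Hf) as [b Hb].
{ split; [eapply Rlt_le_trans; [|apply Rmax_l]; lra|apply Rmax_lub_lt; lra]. }
assert (E : forall n, b n = a n).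
{ apply (power_series_unique f b a (1 / 2)); [lra| |exact Ha].
  intros w Hw; apply Hb; eapply Rlt_le_trans; [exact Hw|apply Rmax_l]. }
apply is_Cseries_ext with (fun n => b n * Cpow z n)%C; [intros n; now rewrite E|].
apply Hb; eapply Rlt_le_trans; [|apply Rmax_r]; lra.
Qed.

Lemma coeffs_spec (f : C -> C) :
  analytic_on_disk f -> expansion_on_disk f (coeffs f).
Proof.
intros Hf.
exact (epsilon_spec (inhabits (fun _ => RtoC 0)) (expansion_on_disk f) (analytic_expansion f Hf)).
Qed.

(** Makes the choice in [coeffs] harmless: any expansion at hand computes Hadamard products. *)
Lemma coeffs_unique (f : C -> C) (a : nat -> C) :
  expansion_on_disk f a -> forall n, coeffs f n = a n.
Proof.
intros Ha; apply (power_series_unique f _ _ 1 Rlt_0_1); [|exact Ha].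
apply (epsilon_spec (inhabits (fun _ => RtoC 0)) (expansion_on_disk f)); now exists a.
Qed.

(** * Operations on Taylor expansions *)

Lemma pow_unit_interval (x : R) (n : nat) : 0 <= x <= 1 -> 0 <= x ^ n <= 1.
Proof. intros Hx; induction n as [|n IH]; simpl; [lra|nra]. Qed.

(** In 1 - x^n = (1 - x) (1 + x + ... + x^(n-1)) each of the n summands is at least x^n. This lets a
    factor n be paid for by a slightly larger radius. *)
Lemma mult_pow_bound (x : R) (n : nat) :
  0 <= x < 1 -> (1 - x) * (INR n * x ^ n) <= 1 - x ^ n.
Proof.
intros Hx; induction n as [|n IH]; [simpl; lra|].
assert (H1 := pow_unit_interval x n ltac:(lra)).
rewrite S_INR; simpl pow.
assert (H2 : x * ((1 - x) * (INR n * x ^ n)) <= x * (1 - x ^ n))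
  by (apply Rmult_le_compat_l; lra).
assert (H3 : (1 - x) * (x * x ^ n) <= (1 - x) * 1)
  by (apply Rmult_le_compat_l; nra).
nra.
Qed.

Lemma disk_summable_mul_INR (u : nat -> C) :
  disk_summable u -> disk_summable (fun n => RtoC (INR n) * u n)%C.
Proof.
intros H r Hr; set (rho := (1 + r) / 2).
assert (Hrho : r < rho < 1) by (unfold rho; lra).
assert (Hx : 0 <= r / rho < 1).
{ split; [apply Rmult_le_pos; [lra|]; left; apply Rinv_0_lt_compat; lra|].
  apply Rmult_lt_reg_r with rho; [lra|]; unfold Rdiv; rewrite Rmult_assoc, Rinv_l; lra. }
apply ex_series_dominated with (fun n => / (1 - r / rho) * (Cmod (u n) * rho ^ n)).
- intros n; rewrite Cmod_mult, Cmod_R, Rabs_right by apply Rle_ge, pos_INR.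
  assert (Hu := Cmod_ge_0 (u n)); assert (Hn := pos_INR n).
  assert (Hrn := pow_le r n (proj1 Hr)); assert (Hp : 0 < rho ^ n) by (apply pow_lt; lra).
  split; [apply Rmult_le_pos; [now apply Rmult_le_pos|exact Hrn]|].
  assert (Hb := mult_pow_bound (r / rho) n Hx).
  assert (H1 := pow_unit_interval (r / rho) n ltac:(lra)).
  set (x := r / rho) in *.
  replace (r ^ n) with (x ^ n * rho ^ n)
    by (rewrite <- Rpow_mult_distr; f_equal; unfold x; field; lra).
  apply (Rmult_le_reg_l (1 - x)); [lra|].
  replace ((1 - x) * (/ (1 - x) * (Cmod (u n) * rho ^ n))) with (1 * (Cmod (u n) * rho ^ n))
    by (field; lra).
  replace ((1 - x) * (INR n * Cmod (u n) * (x ^ n * rho ^ n)))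
    with ((1 - x) * (INR n * x ^ n) * (Cmod (u n) * rho ^ n)) by ring.
  apply Rmult_le_compat_r; [apply Rmult_le_pos; lra|lra].
- apply ex_series_scal_real, H; lra.
Qed.

Lemma disk_summable_shift (u : nat -> C) :
  disk_summable u -> disk_summable (fun n => u (S n)).
Proof.
intros H r Hr; set (rho := (1 + r) / 2).
assert (Hrho : r < rho < 1) by (unfold rho; lra).
assert (Hs := H rho ltac:(lra)); apply ex_series_incr_1 in Hs.
apply ex_series_dominated with (fun n => / rho * (Cmod (u (S n)) * rho ^ S n)).
- intros n; assert (Hu := Cmod_ge_0 (u (S n))).
  assert (Hrn := pow_le r n (proj1 Hr)).
  split; [now apply Rmult_le_pos|].
  replace (/ rho * (Cmod (u (S n)) * rho ^ S n)) with (Cmod (u (S n)) * rho ^ n)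
    by (simpl; field; lra).
  apply Rmult_le_compat_l; [exact Hu|]; apply pow_incr; lra.
- now apply ex_series_scal_real.
Qed.

Lemma disk_summable_mult (u v : nat -> C) :
  disk_summable u -> disk_summable v -> disk_summable (fun n => u n * v n)%C.
Proof.
intros Hu Hv r Hr; set (rho := (1 + r) / 2).
assert (Hrho : r < rho < 1) by (unfold rho; lra).
assert (Hx : 0 <= r / rho < 1).
{ split; [apply Rmult_le_pos; [lra|]; left; apply Rinv_0_lt_compat; lra|].
  apply Rmult_lt_reg_r with rho; [lra|]; unfold Rdiv; rewrite Rmult_assoc, Rinv_l; lra. }
destruct (ex_series_bounded _ (Hv rho ltac:(lra))) as (B & HB & Hb).
apply ex_series_dominated with (fun n => B * (Cmod (u n) * (r / rho) ^ n));
  [|now apply ex_series_scal_real, Hu].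
intros n; specialize (Hb n).
assert (H1 := Cmod_ge_0 (u n)); assert (H2 := Cmod_ge_0 (v n)).
assert (Hp : 0 < rho ^ n) by (apply pow_lt; lra).
rewrite Rabs_right in Hb by (apply Rle_ge, Rmult_le_pos; lra).
rewrite Cmod_mult; split; [apply Rmult_le_pos; [nra|]; apply pow_le; lra|].
set (x := r / rho) in *.
replace (r ^ n) with (x ^ n * rho ^ n)
  by (rewrite <- Rpow_mult_distr; f_equal; unfold x; field; lra).
replace (Cmod (u n) * Cmod (v n) * (x ^ n * rho ^ n))
  with (Cmod (v n) * rho ^ n * (Cmod (u n) * x ^ n)) by ring.
apply Rmult_le_compat_r; [|exact Hb].
apply Rmult_le_pos; [exact H1|apply pow_le; lra].
Qed.

Lemma disk_summable_series (u : nat -> C) (z : C) :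
  disk_summable u -> unit_disk z ->
  is_Cseries (fun n => u n * Cpow z n)%C (CSeries (fun n => u n * Cpow z n)%C).
Proof.
intros H Hz; apply is_Cseries_ex with (fun n => Cmod (u n) * Cmod z ^ n).
- intros n; rewrite Cmod_mult, Cmod_pow; lra.
- apply H; split; [apply Cmod_ge_0|exact Hz].
Qed.

Lemma is_Cseries_unshift (u : nat -> C) (s : C) :
  u 0%nat = 0 -> is_Cseries (fun n => u (S n)) s -> is_Cseries u s.
Proof.
intros H0 H; apply is_series_decr_1.
change (is_Cseries (fun n => u (S n)) (s + - u 0%nat)%C); rewrite H0.
replace (s + - 0)%C with s by ring; exact H.
Qed.

Lemma is_Cseries_shift (u : nat -> C) (s : C) :
  u 0%nat = 0 -> is_Cseries u s -> is_Cseries (fun n => u (S n)) s.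
Proof.
intros H0 H; apply is_series_incr_1.
change (is_Cseries u (s + u 0%nat)%C); rewrite H0.
replace (s + 0)%C with s by ring; exact H.
Qed.

(** With E_n the error, E_(n+1) = w E_n + n z^(n-1) (w - z)^2, and n^2 + n <= (n + 1)^2 closes the
    induction. The factor rho^2 on the left avoids an exponent n - 2; at n = 0 the exponent [pred n]
    comes with the coefficient 0. *)
Lemma pow_taylor_bound (w z : C) (rho : R) (n : nat) :
  0 < rho -> Cmod w <= rho -> Cmod z <= rho ->
  rho ^ 2 * Cmod (Cpow w n - Cpow z n - RtoC (INR n) * Cpow z (pred n) * (w - z))
    <= INR n ^ 2 * rho ^ n * Cmod (w - z) ^ 2.
Proof.
intros Hrho Hw Hz; induction n as [|n IH].
- replace (Cpow w 0 - Cpow z 0 - RtoC (INR 0) * Cpow z (pred 0) * (w - z))%C with (RtoC 0)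
    by (simpl; ring).
  rewrite Cmod_0; simpl; lra.
- set (E := (Cpow w n - Cpow z n - RtoC (INR n) * Cpow z (pred n) * (w - z))%C) in *.
  set (D := (RtoC (INR n) * Cpow z (pred n))%C).
  assert (HD : (D * z = RtoC (INR n) * Cpow z n)%C).
  { unfold D; destruct n as [|k]; simpl; ring. }
  replace (Cpow w (S n) - Cpow z (S n) - RtoC (INR (S n)) * Cpow z (pred (S n)) * (w - z))%C
    with (w * E + D * ((w - z) * (w - z)))%C.
  2:{ rewrite S_INR, RtoC_plus; simpl pred; rewrite !Cpow_S.
      replace (D * ((w - z) * (w - z)))%C with ((D * w - D * z) * (w - z))%C by ring.
      rewrite HD; unfold E; fold D; ring. }
  assert (HE := Cmod_ge_0 E); assert (Hh := Cmod_ge_0 (w - z)); assert (Hn := pos_INR n).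
  assert (HDb : rho ^ 2 * Cmod D <= INR n * (rho * rho ^ n)).
  { unfold D; rewrite Cmod_mult, Cmod_R, Rabs_right by apply Rle_ge, pos_INR.
    destruct n as [|k]; [simpl; lra|]; simpl pred.
    assert (Hk : Cmod (Cpow z k) <= rho ^ k).
    { rewrite Cmod_pow; apply pow_incr; split; [apply Cmod_ge_0|exact Hz]. }
    replace (INR (S k) * (rho * rho ^ S k)) with (rho ^ 2 * (INR (S k) * rho ^ k)) by (simpl pow; ring).
    apply Rmult_le_compat_l; [nra|]; now apply Rmult_le_compat_l. }
  set (h := Cmod (w - z)) in *.
  assert (HT : Cmod (w * E + D * ((w - z) * (w - z))) <= rho * Cmod E + Cmod D * h ^ 2).
  { eapply Rle_trans; [apply Cmod_triangle|]; rewrite !Cmod_mult; fold h.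
    apply Rplus_le_compat; [now apply Rmult_le_compat_r|right; ring]. }
  assert (HP : 0 < rho ^ n) by now apply pow_lt.
  assert (Hh2 : 0 <= h ^ 2) by nra.
  apply (Rmult_le_compat_l (rho ^ 2)) in HT; [|nra].
  apply (Rmult_le_compat_r (h ^ 2)) in HDb; [|exact Hh2].
  apply (Rmult_le_compat_l rho) in IH; [|lra].
  eapply Rle_trans; [exact HT|].
  apply Rle_trans with (rho * (INR n ^ 2 * rho ^ n * h ^ 2) + INR n * (rho * rho ^ n) * h ^ 2); [lra|].
  rewrite S_INR; simpl (rho ^ S n).
  assert (HX : 0 <= rho * rho ^ n * h ^ 2) by (apply Rmult_le_pos; nra).
  nra.
Qed.

Lemma expansion_is_derive (f : C -> C) (u : nat -> C) (z : C) :
  expansion_on_disk f u -> unit_disk z ->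
  @is_derive C_AbsRing C_NormedModule f z
    (CSeries (fun n => RtoC (INR (S n)) * u (S n) * Cpow z n)%C).
Proof.
intros Hf Hz; unfold unit_disk in Hz.
assert (Hu := expansion_summable _ _ Hf).
assert (Hd := disk_summable_mul_INR _ Hu).
assert (Hs := disk_summable_series _ z (disk_summable_shift _ Hd) Hz).
set (D := CSeries _) in *.
assert (HD : is_Cseries (fun n => RtoC (INR n) * u n * Cpow z (pred n))%C D).
{ apply is_Cseries_unshift; [simpl; ring|exact Hs]. }
set (rho := (1 + Cmod z) / 2); assert (Hz0 := Cmod_ge_0 z).
assert (HR : Cmod z < rho < 1) by (unfold rho; lra).
assert (HM : exists S0 : R, is_series (fun n => Cmod (RtoC (INR n) * (RtoC (INR n) * u n)) * rho ^ n) S0)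
  by exact (disk_summable_mul_INR _ Hd rho ltac:(lra)).
destruct HM as [S0 HS].
assert (HS0 : 0 <= S0).
{ eapply Rle_trans; [apply Rabs_pos|]; refine (is_series_le_abs (fun _ => 0) _ 0 S0 _ _ HS).
  - intros n; rewrite Rabs_R0; apply Rmult_le_pos; [apply Cmod_ge_0|apply pow_le; lra].
  - change (is_lim_seq (sum_n (fun _ => 0)) 0).
    apply is_lim_seq_ext with (fun _ => 0); [|apply is_lim_seq_const].
    intros k; rewrite sum_n_const; ring. }
apply C_is_derive_eps; intros eps Heps.
assert (HR2 : 0 < rho ^ 2) by nra.
(* [S0] is the sum of n^2 |u_n| rho^n, and the 2 is that of [is_Cseries_bound], so the error of the
   derivative is at most K |w - z|^2. The 1 makes K positive. *)
set (K := 2 * (/ rho ^ 2 * S0) + 1).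
assert (HK : 1 <= K).
{ unfold K; assert (H0 : 0 <= / rho ^ 2 * S0); [|lra].
  apply Rmult_le_pos; [left; now apply Rinv_0_lt_compat|exact HS0]. }
exists (Rmin (rho - Cmod z) (eps / K)); split.
{ apply Rmin_glb_lt; [lra|]; apply Rdiv_lt_0_compat; lra. }
intros w Hw.
assert (Hw1 := Rlt_le_trans _ _ _ Hw (Rmin_l _ _)).
assert (Hw2 := Rlt_le_trans _ _ _ Hw (Rmin_r _ _)).
assert (HwR : Cmod w <= rho).
{ assert (T := Cmod_triangle z (w - z)); replace (z + (w - z))%C with w in T by ring; lra. }
assert (Hsum : is_Cseries (fun n => u n * (Cpow w n - Cpow z n - RtoC (INR n) * Cpow z (pred n) * (w - z)))%C
                 (f w - f z - D * (w - z))%C).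
{ replace (f w - f z - D * (w - z))%C with (f w + (-1) * f z + (- (w - z)) * D)%C by ring.
  apply is_Cseries_ext with (fun n => u n * Cpow w n + (-1) * (u n * Cpow z n)
     + (- (w - z)) * (RtoC (INR n) * u n * Cpow z (pred n)))%C; [intros n; ring|].
  apply is_Cseries_plus; [apply is_Cseries_plus|].
  - apply Hf; unfold unit_disk; lra.
  - apply is_Cseries_scal, Hf; unfold unit_disk; lra.
  - now apply is_Cseries_scal. }
set (h := Cmod (w - z)) in *; assert (Hh : 0 <= h) by apply Cmod_ge_0.
assert (HB := fun A B => is_Cseries_bound _ (fun n => h ^ 2 * / rho ^ 2 *
   (Cmod (RtoC (INR n) * (RtoC (INR n) * u n)) * rho ^ n)) _ (h ^ 2 * / rho ^ 2 * S0) A Hsum B).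
eapply Rle_trans; [apply HB|].
- intros n; assert (T := pow_taylor_bound w z rho n ltac:(lra) HwR ltac:(lra)).
  fold h in T.
  rewrite !Cmod_mult, Cmod_R, Rabs_right by apply Rle_ge, pos_INR.
  apply (Rmult_le_reg_l (rho ^ 2)); [exact HR2|].
  apply (Rmult_le_compat_l (Cmod (u n))) in T; [|apply Cmod_ge_0].
  replace (rho ^ 2 * (h ^ 2 * / rho ^ 2 * (INR n * (INR n * Cmod (u n)) * rho ^ n)))
    with (Cmod (u n) * (INR n ^ 2 * rho ^ n * h ^ 2)) by (field; lra).
  eapply Rle_trans; [right|exact T]; ring.
- exact (is_series_scal (V := R_NormedModule) _ _ _ HS).
- apply Rle_trans with (K * h * h).
  + unfold K; assert (0 <= h * h) by nra; nra.
  + apply Rmult_le_compat_r; [exact Hh|].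
    apply (Rmult_lt_compat_l K) in Hw2; [|lra].
    replace (K * (eps / K)) with eps in Hw2 by (field; lra); lra.
Qed.

Lemma expansion_analytic (f : C -> C) (u : nat -> C) :
  expansion_on_disk f u -> analytic_on_disk f.
Proof. intros H z Hz; eexists; now apply expansion_is_derive with (1 := H). Qed.

(** The hypothesis concerns values on the disk only, so the lemma applies again to [C_derive f] and
    yields the second derivative. *)
Lemma expansion_C_derive (f : C -> C) (u : nat -> C) :
  expansion_on_disk f u ->
  expansion_on_disk (C_derive f) (fun n => RtoC (INR (S n)) * u (S n))%C.
Proof.
intros H z Hz.
rewrite (is_C_derive_unique _ _ _ (expansion_is_derive f u z H Hz)).
apply (disk_summable_series (fun n => RtoC (INR (S n)) * u (S n))%C); [|exact Hz].
apply (disk_summable_shift (fun n => RtoC (INR n) * u n)%C).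
apply disk_summable_mul_INR; exact (expansion_summable _ _ H).
Qed.

Lemma unit_disk_0 : unit_disk 0.
Proof. unfold unit_disk; rewrite Cmod_0; lra. Qed.

Lemma expansion_at_0 (f : C -> C) (u : nat -> C) :
  expansion_on_disk f u -> f 0 = u 0%nat.
Proof.
intros H; specialize (H 0 unit_disk_0); apply (is_Cseries_single _ 0) in H.
- rewrite H; simpl; ring.
- intros [|k] Hk; [tauto|]; simpl; ring.
Qed.

Lemma expansion_C_derive_at_0 (f : C -> C) (u : nat -> C) :
  expansion_on_disk f u -> C_derive f 0 = u 1%nat.
Proof.
intros H; rewrite (expansion_at_0 _ _ (expansion_C_derive _ _ H)); simpl INR; ring.
Qed.

Lemma expansion_plus (f g : C -> C) (u v : nat -> C) :
  expansion_on_disk f u -> expansion_on_disk g v ->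
  expansion_on_disk (fun z => f z + g z)%C (fun n => u n + v n)%C.
Proof.
intros Hf Hg z Hz.
apply is_Cseries_ext with (2 := is_Cseries_plus _ _ _ _ (Hf z Hz) (Hg z Hz)); intros n; ring.
Qed.

Lemma expansion_scal (c : C) (f : C -> C) (u : nat -> C) :
  expansion_on_disk f u -> expansion_on_disk (fun z => c * f z)%C (fun n => c * u n)%C.
Proof.
intros Hf z Hz.
apply is_Cseries_ext with (2 := is_Cseries_scal c _ _ (Hf z Hz)); intros n; ring.
Qed.

Lemma expansion_const (c : C) :
  expansion_on_disk (fun _ => c) (fun n => if Nat.eqb n 0 then c else 0).
Proof.
intros z Hz; apply is_Cseries_components; split.
- apply is_series_ext with (2 := is_series_single 0 (Re c)).
  intros [|k]; unfold Re; simpl; ring.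
- apply is_series_ext with (2 := is_series_single 0 (Im c)).
  intros [|k]; unfold Im; simpl; ring.
Qed.

Lemma expansion_mul_id (f : C -> C) (u : nat -> C) :
  u 0%nat = 0 -> expansion_on_disk f (fun n => u (S n)) ->
  expansion_on_disk (fun z => z * f z)%C u.
Proof.
intros H0 Hf z Hz; apply is_Cseries_unshift; [rewrite H0; ring|].
apply is_Cseries_ext with (2 := is_Cseries_scal z _ _ (Hf z Hz)); intros n; simpl; ring.
Qed.

Lemma expansion_hadamard (f g : C -> C) (u v : nat -> C) :
  expansion_on_disk f u -> expansion_on_disk g v ->
  expansion_on_disk (hadamard f g) (fun n => u n * v n)%C.
Proof.
intros Hf Hg z Hz.
assert (H := disk_summable_series _ z (disk_summable_mult _ _
  (expansion_summable _ _ Hf) (expansion_summable _ _ Hg)) Hz).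
set (s := CSeries _) in H.
replace (hadamard f g z) with s; [exact H|].
symmetry; apply is_Cseries_unique; apply is_Cseries_ext with (2 := H).
intros n; now rewrite (coeffs_unique f u Hf), (coeffs_unique g v Hg).
Qed.

(** The value 1 prescribed at the origin is u_1, the constant term of the shifted series. *)
Lemma expansion_div_id (f : C -> C) (u : nat -> C) :
  expansion_on_disk f u -> u 0%nat = 0 -> u 1%nat = 1 ->
  expansion_on_disk (div_id f) (fun n => u (S n)).
Proof.
intros Hf H0 H1 z Hz; unfold div_id.
destruct (Ceq_dec z 0) as [->|Hz0].
- assert (H := disk_summable_series _ 0 (disk_summable_shift _ (expansion_summable _ _ Hf)) unit_disk_0).
  set (s := CSeries _) in H.
  assert (E : s = (u 1%nat * Cpow 0 0)%C).
  { apply (is_Cseries_single (fun n => u (S n) * Cpow 0 n)%C 0) with (2 := H).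
    intros [|k] Hk; [tauto|simpl; ring]. }
  replace (RtoC 1) with s; [exact H|]; rewrite E, H1; simpl; ring.
- assert (H := is_Cseries_shift (fun n => u n * Cpow z n)%C _ ltac:(simpl; rewrite H0; ring) (Hf z Hz)).
  replace (f z / z)%C with (/ z * f z)%C by (unfold Cdiv; ring).
  apply is_Cseries_ext with (2 := is_Cseries_scal (/ z)%C _ _ H).
  intros n; simpl; field; exact Hz0.
Qed.

(** * The differential operator of the class *)

Definition multiplier_op (alpha : R) (psi : C -> C) (z : C) : C :=
  (RtoC (1 - alpha) * C_derive psi z + RtoC alpha * z * C_derive (C_derive psi) z)%C.

(** The sum of (1 - alpha) (n + 1), from the first derivative, and alpha n (n + 1), from z times the
    second; it weights the coefficient of index n + 1. *)
Definition multiplier (alpha : R) (n : nat) : C :=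
  RtoC (INR (S n) * ((1 - alpha) + alpha * INR n)).

Lemma expansion_multiplier_op (alpha : R) (f : C -> C) (u : nat -> C) :
  expansion_on_disk f u ->
  expansion_on_disk (multiplier_op alpha f) (fun n => multiplier alpha n * u (S n))%C.
Proof.
intros Hf.
assert (H1 := expansion_C_derive _ _ Hf).
assert (H2 := expansion_C_derive _ _ H1).
assert (H3 := expansion_mul_id (C_derive (C_derive f))
  (fun n => RtoC (INR n) * (RtoC (INR (S n)) * u (S n)))%C ltac:(simpl; ring) H2).
intros z Hz.
assert (H := expansion_plus _ _ _ _ (expansion_scal (RtoC (1 - alpha)) _ _ H1)
  (expansion_scal (RtoC alpha) _ _ H3) z Hz); simpl in H.
unfold multiplier_op.
replace (RtoC alpha * z * C_derive (C_derive f) z)%C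
  with (RtoC alpha * (z * C_derive (C_derive f) z))%C by ring.
apply is_Cseries_ext with (2 := H); intros n; unfold multiplier.
rewrite RtoC_mult, RtoC_plus, RtoC_mult; change (match n with 0%nat => 1 | S _ => INR n + 1 end) with (INR (S n)); ring.
Qed.

(** * Positivity of convolutions *)

Lemma circle_int_pos (F : R -> C) (L : C) :
  path_continuous F -> (forall t, 0 < Re (F t)) -> is_circle_int F L -> 0 < Re L.
Proof.
intros HF Hp [H _].
replace (Re L) with (RInt (fun t => Re (F t)) 0 (2 * PI)) by now apply is_RInt_unique.
apply RInt_gt_0; [apply two_PI_pos|auto|]; intros t _; apply HF.
Qed.

(* On the circle of radius [s] the kernel [K] is [2 Re p - 1] at
   [zeta * cis (- t)], where [z = s * zeta]; its Fourier coefficients are the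
   [p_n zeta^n]. *)
Lemma hadamard_re_pos (SQ Sp : C -> C) (Q p : nat -> C) (z T : C) :
  expansion_on_disk SQ Q -> expansion_on_disk Sp p -> p 0%nat = 1 ->
  (forall w, unit_disk w -> 0 < Re (SQ w)) ->
  (forall w, unit_disk w -> 1 / 2 < Re (Sp w)) ->
  unit_disk z -> is_Cseries (fun n => Q n * p n * Cpow z n)%C T ->
  0 < Re T.
Proof.
intros HQ Hp Hp0 HQpos Hppos Hz HT; unfold unit_disk in Hz; assert (H2 := two_PI_pos).
assert (Hz0 := Cmod_ge_0 z).
set (s := (1 + Cmod z) / 2); assert (Hs : Cmod z < s < 1) by (unfold s; lra).
assert (Hs0 : RtoC s <> 0) by (apply Cmod_gt_0; rewrite Cmod_R, Rabs_right; lra).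
(* Splitting z as s zeta places the arguments of [SQ] on the circle of radius s and those of [Sp] on
   the circle of radius |zeta|, both inside the disk. *)
set (zeta := (z / RtoC s)%C).
assert (Hzeta : Cmod zeta < 1).
{ unfold zeta; rewrite Cmod_div, Cmod_R, Rabs_right by (exact Hs0 || lra).
  apply Rmult_lt_reg_r with s; [lra|]; unfold Rdiv; rewrite Rmult_assoc, Rinv_l; lra. }
assert (Hzs : z = (RtoC s * zeta)%C) by (unfold zeta; field; exact Hs0).
pose (w := fun n => (p n * Cpow zeta n)%C).
assert (Hw0 : w 0%nat = 1) by (unfold w; rewrite Hp0; simpl; ring).
assert (Hwsum : ex_series (fun n => Cmod (Cconj (w n)))).
{ apply ex_series_ext with (fun n => Cmod (p n) * Cmod zeta ^ n).
  - intros n; unfold w; now rewrite Cmod_conj, Cmod_mult, Cmod_pow.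
  - apply (expansion_summable _ _ Hp); split; [apply Cmod_ge_0|exact Hzeta]. }
assert (Hdisk : forall t, unit_disk (zeta * cis (-1 * t))).
{ intros t; unfold unit_disk; rewrite Cmod_mult, Cmod_cis; lra. }
(* Conjugation turns the frequencies - n into n, the form that [circle_int_coeff] takes. *)
pose (F := fun t => Cconj (Sp (zeta * cis (-1 * t))%C)).
assert (HFc : path_continuous F).
{ apply path_continuous_conj, path_continuous_comp.
  - apply path_continuous_mult; [apply path_continuous_const|apply path_continuous_cis].
  - intros t; apply C_ex_derive_continuous, (expansion_analytic _ _ Hp), Hdisk. }
assert (HFs : forall t, is_Cseries (fun n => Cconj (w n) * cis (INR n * t))%C (F t)).
{ intros t; apply is_Cseries_ext with (2 := is_Cseries_conj _ _ (Hp _ (Hdisk t))).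
  intros n; unfold w; rewrite Cpow_mult_l, cis_pow, !Cmult_conj, <- cis_opp.
  replace (- (INR n * (-1 * t))) with (INR n * t) by ring; ring. }
pose (K := fun t => (F t + Cconj (F t) + RtoC (-1))%C).
assert (HKc : path_continuous K).
{ apply path_continuous_plus; [|apply path_continuous_const].
  apply path_continuous_plus; [exact HFc|now apply path_continuous_conj]. }
assert (HK : forall n, is_circle_int (fun t => cis (INR n * t) * K t)%C (RtoC (2 * PI) * w n)%C).
{ intros n.
  (* [X] is the integral of the n-th mode. [F] also contributes [X], because w_0 = 1, and the -1 in
     [K] takes it back; the conjugate of [F] leaves 2 PI w_n. *)
  pose (X := if Nat.eqb n 0 then RtoC (2 * PI) else RtoC 0).
  assert (I1 : is_circle_int (fun t => cis (INR n * t)) X).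
  { unfold X; destruct n as [|n]; simpl Nat.eqb.
    - replace (RtoC (2 * PI)) with (RtoC (2 * PI) * 1)%C by ring.
      apply is_circle_int_ext with (fun _ => RtoC 1); [|apply is_circle_int_const].
      intros t; simpl INR; now rewrite Rmult_0_l, cis_0.
    - rewrite INR_IZR_INZ; apply is_circle_int_cis; lia. }
  assert (I2 : is_circle_int (fun t => F t * cis (INR n * t))%C X).
  { assert (I := circle_int_correct _ (path_continuous_mult _ _ HFc (path_continuous_cis (INR n)))).
    simpl in I; set (L := circle_int _) in I.
    replace X with L; [exact I|].
    assert (I' : is_circle_int (fun t => F t * cis (- IZR (- Z.of_nat n) * t))%C L).
    { apply is_circle_int_ext with (2 := I); intros t.
      now rewrite opp_IZR, Ropp_involutive, <- INR_IZR_INZ. }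
    assert (Hser := circle_int_coeff _ F _ L Hwsum HFs I').
    apply (is_Cseries_single _ 0) in Hser.
    - rewrite Hser, Hw0; unfold X; destruct n as [|n]; [|reflexivity].
      simpl; unfold Cconj; simpl.
      apply injective_projections; simpl; ring.
    - intros k Hk; destruct (Z.eqb_spec (Z.of_nat k) (- Z.of_nat n)); [lia|reflexivity]. }
  assert (I3 : is_circle_int (fun t => Cconj (F t) * cis (INR n * t))%C (RtoC (2 * PI) * w n)%C).
  { assert (I := circle_int_correct _ (path_continuous_mult _ _ HFc (path_continuous_cis (- INR n)))).
    simpl in I; set (L := circle_int _) in I.
    assert (E := circle_int_coeff_nat _ F n L Hwsum HFs I); simpl in E.
    apply is_circle_int_conj in I; rewrite E in I.
    replace (RtoC (2 * PI) * w n)%C with (Cconj (RtoC (2 * PI) * Cconj (w n))).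
    - apply is_circle_int_ext with (2 := I); intros t.
      rewrite Cmult_conj, <- cis_opp; do 2 f_equal; ring.
    - rewrite Cmult_conj, Cconj_conj; f_equal; unfold Cconj, RtoC; simpl; f_equal; ring. }
  replace (RtoC (2 * PI) * w n)%C with (X + RtoC (2 * PI) * w n + RtoC (-1) * X)%C by ring.
  eapply is_circle_int_ext; [|exact (is_circle_int_plus _ _ _ _
    (is_circle_int_plus _ _ _ _ I2 I3) (is_circle_int_scal (RtoC (-1)) _ _ I1))].
  intros t; unfold K; simpl; ring. }
assert (Hpol : forall t, unit_disk (pol s t)).
{ intros t; unfold unit_disk; rewrite Cmod_pol; lra. }
assert (HSQc : path_continuous (fun t => SQ (pol s t))).
{ apply path_continuous_comp; [apply path_continuous_pol|].
  intros t; apply C_ex_derive_continuous, (expansion_analytic _ _ HQ), Hpol. }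
assert (HGc := path_continuous_mult _ _ HSQc HKc); simpl in HGc.
assert (HI := circle_int_correct _ HGc); set (L := circle_int _) in HI.
destruct (path_continuous_bounded _ HKc) as (B & HB & HKb).
assert (HL : is_Cseries (fun n => Q n * Cpow (RtoC s) n * (RtoC (2 * PI) * w n))%C L).
{ apply (is_circle_int_series (fun n t => Q n * Cpow (RtoC s) n * (cis (INR n * t) * K t))%C
    _ (fun n => B * (Cmod (Q n) * s ^ n)) _ _) with (2 := HI).
  - intros n; apply is_circle_int_scal, HK.
  - intros n t Ht; specialize (HKb t Ht).
    rewrite !Cmod_mult, Cmod_pow, Cmod_R, Cmod_cis, Rabs_right by lra.
    rewrite (Rmult_comm B), Rmult_1_l; apply Rmult_le_compat_l; [|exact HKb].
    apply Rmult_le_pos; [apply Cmod_ge_0|apply pow_le; lra].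
  - apply ex_series_scal_real, (expansion_summable _ _ HQ); lra.
  - intros t _; apply is_Cseries_ext with (fun n => K t * (Q n * Cpow (pol s t) n))%C.
    + intros n; rewrite pol_cis, Cpow_mult_l, cis_pow; ring.
    + rewrite (Cmult_comm (SQ _)); apply is_Cseries_scal, HQ, Hpol. }
assert (EL : L = (RtoC (2 * PI) * T)%C).
{ rewrite <- (is_Cseries_unique _ _ HL); apply is_Cseries_unique.
  apply is_Cseries_ext with (2 := is_Cseries_scal (RtoC (2 * PI)) _ _ HT).
  intros n; unfold w; rewrite Hzs, Cpow_mult_l; ring. }
assert (HLpos : 0 < Re L).
{ apply (circle_int_pos _ _ HGc) with (2 := HI); intros t.
  assert (P1 := HQpos _ (Hpol t)); assert (P2 := Hppos _ (Hdisk t)).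
  (* [K] is real-valued, so it comes out of the real part. *)
  replace (Re (SQ (pol s t) * K t)%C) with (Re (SQ (pol s t)) * (2 * Re (Sp (zeta * cis (-1 * t))%C) - 1)).
  - apply Rmult_lt_0_compat; lra.
  - unfold K, F; rewrite Cconj_conj; unfold Re, Cconj, Cmult, Cplus, RtoC; simpl; ring. }
rewrite EL in HLpos; unfold Re, Cmult, RtoC in HLpos; simpl in HLpos.
unfold Re; nra.
Qed.

(** This e makes Re (e w) as small as possible, the worst case of the inequality to be proved. *)
Lemma exists_unit_rotation (w : C) : exists e, Cmod e = 1 /\ (e * w)%C = RtoC (- Cmod w).
Proof.
destruct (Ceq_dec w 0) as [->|Hw].
- exists (RtoC 1); split; [apply Cmod_1|]; rewrite Cmod_0, Ropp_0; ring.
- assert (Hp : 0 < Cmod w) by now apply Cmod_gt_0.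
  assert (Hc : RtoC (Cmod w) <> 0) by (apply Cmod_gt_0; rewrite Cmod_R, Rabs_right; lra).
  exists (- (Cconj w / RtoC (Cmod w)))%C; split.
  + rewrite Cmod_opp, Cmod_div, Cmod_conj, Cmod_R, Rabs_right by (exact Hc || lra).
    field; lra.
  + replace (- (Cconj w / RtoC (Cmod w)) * w)%C with (- ((w * Cconj w) / RtoC (Cmod w)))%C
      by (field; exact Hc).
    rewrite <- Cmod2_conj, RtoC_opp, RtoC_pow; field; exact Hc.
Qed.

Theorem theorem3p4 :
  forall (M alpha : R) (h g : C -> C) (a b : nat -> C) (phi : C -> C),
    0 < M ->
    0 < alpha <= 1 ->
    class_PH0 alpha M (Harm h g) ->
    (forall z : C, unit_disk z ->
       is_Cseries (fun k => (a (k + 2)%nat * Cpow z (k + 2))%C) (h z - z)%C) ->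
    (forall z : C, unit_disk z ->
       is_Cseries (fun k => (b (k + 2)%nat * Cpow z (k + 2))%C) (g z)) ->
    class_A phi ->
    (forall z : C, unit_disk z -> Re (div_id phi z) > 1 / 2) ->
    forall beta : C, Cmod beta = 1 ->
      class_PH0 alpha M (harm_conv (Harm h g) (plus_conj phi beta)).
Proof.
intros M alpha h g a b phi _ _ [(Hh & Hg & Hh0 & Hh1 & Hg0) [Hg1 Hineq]] _ _
  (Hphi & Hphi0 & Hphi1) Hre beta Hbeta.
simpl in Hh, Hg, Hh0, Hh1, Hg0, Hg1, Hineq.
apply coeffs_spec in Hh, Hg, Hphi.
set (u := coeffs h) in *; set (v := coeffs g) in *; set (c := coeffs phi) in *.
rewrite (expansion_at_0 _ _ Hh) in Hh0; rewrite (expansion_C_derive_at_0 _ _ Hh) in Hh1.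
rewrite (expansion_at_0 _ _ Hg) in Hg0; rewrite (expansion_C_derive_at_0 _ _ Hg) in Hg1.
rewrite (expansion_at_0 _ _ Hphi) in Hphi0; rewrite (expansion_C_derive_at_0 _ _ Hphi) in Hphi1.
assert (HH := expansion_hadamard _ _ _ _ Hh Hphi).
assert (HG := expansion_hadamard _ _ _ _ Hg (expansion_scal (Cconj beta) _ _ Hphi)).
unfold class_PH0, class_H, harm_conv, plus_conj; simpl.
set (H := hadamard h phi) in *.
set (G := hadamard g (fun z => Cconj beta * phi z)%C) in *.
rewrite (expansion_at_0 _ _ HH), (expansion_C_derive_at_0 _ _ HH),
  (expansion_at_0 _ _ HG), (expansion_C_derive_at_0 _ _ HG).
rewrite Hh0, Hh1, Hg0, Hg1, Hphi0, Hphi1.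
repeat split; try ring; try (now apply expansion_analytic with (1 := HH));
  try (now apply expansion_analytic with (1 := HG)).
intros z Hz.
change (Re (multiplier_op alpha H z) > - M + Cmod (multiplier_op alpha G z)).
destruct (exists_unit_rotation (multiplier_op alpha G z)) as (e' & He' & Ee').
(* The co-analytic factor of the convolution is conj(beta) phi. Moving its constant to the side of g
   turns the rotation e' of L G into the rotation e of L g, again of modulus 1. *)
set (e := (e' * Cconj beta)%C).
assert (He : Cmod e = 1) by (unfold e; rewrite Cmod_mult, Cmod_conj, He', Hbeta; ring).
assert (HQ := expansion_plus _ _ _ _
  (expansion_plus _ _ _ _ (expansion_multiplier_op alpha _ _ Hh)
     (expansion_scal e _ _ (expansion_multiplier_op alpha _ _ Hg)))
  (expansion_const (RtoC M))).
assert (HT : 0 < Re (multiplier_op alpha H z + e' * multiplier_op alpha G z + RtoC M)%C).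
{ eapply (hadamard_re_pos _ _ _ _ z _ HQ (expansion_div_id _ _ Hphi Hphi0 Hphi1)).
  - exact Hphi1.
  - intros w Hw; simpl.
    specialize (Hineq w Hw).
    change (Re (multiplier_op alpha h w) > - M + Cmod (multiplier_op alpha g w)) in Hineq.
    assert (B := re_le_Cmod (e * multiplier_op alpha g w)%C).
    rewrite Cmod_mult, He, Rmult_1_l in B; apply Rabs_le_between in B.
    change (0 < Re (multiplier_op alpha h w) + Re (e * multiplier_op alpha g w)%C + M); lra.
  - intros w Hw; apply Rgt_lt, Hre, Hw.
  - exact Hz.
  - assert (HS := expansion_plus _ _ _ _
      (expansion_plus _ _ _ _ (expansion_multiplier_op alpha _ _ HH)
        (expansion_scal e' _ _ (expansion_multiplier_op alpha _ _ HG)))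
      (expansion_const (RtoC M)) z Hz); simpl in HS.
    apply is_Cseries_ext with (2 := HS); intros n; unfold e.
    (* At index 0 the constant M is multiplied by the first coefficient of phi, which is 1, so it
       survives the convolution. *)
    destruct n as [|n]; simpl Nat.eqb; cbv iota; [rewrite Hphi1|]; ring. }
rewrite Ee' in HT.
change (0 < Re (multiplier_op alpha H z) + - Cmod (multiplier_op alpha G z) + M) in HT; lra.
Qed.
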